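(* Let $C$ be a coalgebra, let $(\mathscr{W}_1,\delta)$ be a first-order codifferential calculus over $C$ with maximal prolongation $\mathscr{W}_\bullet^{\mathrm{max}}$, and let $D_\bullet$ be a dg coalgebra with $D:=D_0$, so that $\underline{\mathscr{W}_1}(D_\bullet)$ is a first-order codifferential calculus over $D$. Then any codifferentiable map $f\colon D\to C$ (with respect to $\underline{\mathscr{W}_1}(D_\bullet)$ and $\mathscr{W}_1$) extends uniquely to a morphism of dg coalgebras $f^\flat\colon D_\bullet\to\mathscr{W}_\bullet^{\mathrm{max}}$ (i.e. $f^\flat$ restricted to degree $0$ is $f$). In particular, the maximal prolongation determines a functor $\mathbf{FOCC}\to\mathbf{dgCoalg}$ which is right adjoint to $\underline{\mathscr{W}_1}(-)\colon\mathbf{dgCoalg}\to\mathbf{FOCC}$.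
   Context: Throughout, $k$ is a field with $\mathrm{char}(k)\neq 2$; vector spaces, (coassociative counital) coalgebras and tensor products are over $k$. Sweedler notation: $\Delta(c)=c_{(1)}\otimes c_{(2)}$; in a $C$-bicomodule $W$ (commuting left and right $C$-coactions) write $w\mapsto w_{(-1)}\otimes w_{(0)}\in C\otimes W$ and $w\mapsto w_{(0)}\otimes w_{(1)}\in W\otimes C$. A map of bicomodules commuting with both coactions is called bicolinear. Coderivation: a linear map $\delta\colon W\to C$ with $\Delta(\delta(w))=\delta(w_{(0)})\otimes w_{(1)}+w_{(-1)}\otimes\delta(w_{(0)})$. A first-order codifferential calculus (FOCC) over $C$ is a $C$-bicomodule $\mathscr{W}_1$ with a coderivation $\delta\colon\mathscr{W}_1\to C$ such that $\mathscr{W}_1\to C\otimes C$, $w\mapsto w_{(-1)}\otimes\delta(w_{(0)})$ is injective. Universal FOCC: $\mathscr{W}_1^u=(C\otimes C)/\mathrm{im}(\Delta)$ with coactions $[c\otimes d]\mapsto c_{(1)}\otimes[c_{(2)}\otimes d]$, $[c\otimes d]\mapsto[c\otimes d_{(1)}]\otimes d_{(2)}$ and $\delta^u([c\otimes d])=\varepsilon(c)d-\varepsilon(d)c$. For a coderivation $\delta\colon W\to C$ there is a unique bicolinear $\varphi\colon W\to\mathscr{W}_1^u$ with $\delta^u\circ\varphi=\delta$, namely $\varphi(w)=[w_{(-1)}\otimes\delta(w_{(0)})]$; it is injective if $(W,\delta)$ is an FOCC. Codifferentiable maps: given FOCCs $(\mathscr{W}_1^C,\delta^C)$ over $C$ and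 $(\mathscr{W}_1^D,\delta^D)$ over $D$, a coalgebra morphism $\varphi\colon C\to D$ is codifferentiable if there is a $D$-bicolinear map $\varphi^\delta\colon\mathscr{W}_1^C\to\mathscr{W}_1^D$ with $\delta^D\circ\varphi^\delta=\varphi\circ\delta^C$, where $\mathscr{W}_1^C$ is a $D$-bicomodule by applying $\varphi$ to the $C$-legs of its coactions. $\mathbf{FOCC}$ is the category of pairs (coalgebra, FOCC over it) with codifferentiable maps as morphisms. dg coalgebras: a coalgebra $D_\bullet=\bigoplus_{n\ge0}D_n$ with $\Delta(D_n)\subseteq\bigoplus_{i=0}^nD_{n-i}\otimes D_i$ and a linear map $\delta$ of degree $-1$ with $\delta^2=0$ and $\Delta(\delta(c))=\delta(c_{(1)})\otimes c_{(2)}+(-1)^{|c_{(1)}|}c_{(1)}\otimes\delta(c_{(2)})$ for homogeneous $c$. Morphisms are degree-preserving coalgebra maps commuting with $\delta$; the category is $\mathbf{dgCoalg}$. $D_0$ is a subcoalgebra, each $D_n$ is a $D_0$-bicomodule (project one leg of the coproduct to $D_0$), and $\delta_1\colon D_1\to D_0$ is a coderivation. Let $\underline{\mathscr{W}_1}(D_\bullet):=D_1/\ker(\varphi)$, where $\varphi\colon D_1\to\mathscr{W}_1^u$ is the canonical map into the universal FOCC over $D_0$; with the induced coderivation it is an FOCC over $D_0$. This gives a functor $\underline{\mathscr{W}_1}(-)\colon\mathbf{dgCoalg}\to\mathbf{FOCC}$, sending a morphism $f$ to its degree $0$ part $f_0$. Cotensor product: for a right $C$-comodule $M$ and a left $C$-comodule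 $N$, $M\square_CN=\{u\in M\otimes N:(\Delta_M\otimes\mathrm{id})(u)=(\mathrm{id}\otimes{}_N\Delta)(u)\}$, where $\Delta_M,{}_N\Delta$ are the coactions; elements are written symbolically $m\square_Cn$ (not nec. elementary tensors). For bicomodules it is a bicomodule via the outer coactions. Maximal prolongation of an FOCC $(\mathscr{W}_1,\delta)$ over $C$: let $\check\delta_2\colon\mathscr{W}_1\square_C\mathscr{W}_1\to\mathscr{W}_1^u$, $w_1\square_Cw_2\mapsto[\delta(w_1)\otimes\delta(w_2)]$. $\mathscr{W}_2^{\mathrm{max}}$ is the largest sub-$C$-bicomodule of $\mathscr{W}_1\square_C\mathscr{W}_1$ with $\check\delta_2(\mathscr{W}_2^{\mathrm{max}})\subseteq\varphi(\mathscr{W}_1)$, and $\delta_2\colon\mathscr{W}_2^{\mathrm{max}}\to\mathscr{W}_1$ is determined by $\varphi\circ\delta_2=\check\delta_2$. Put $\mathscr{W}_0^{\mathrm{max}}=C$, $\mathscr{W}_1^{\mathrm{max}}=\mathscr{W}_1$, $\delta_1=\delta$, and for $n\ge2$ $$\mathscr{W}_n^{\mathrm{max}}=\bigcap_{i+j+2=n}\mathscr{W}_1^{\square_Ci}\square_C\mathscr{W}_2^{\mathrm{max}}\square_C\mathscr{W}_1^{\square_Cj},\qquad\delta_n(w_1\square_C\cdots\square_Cw_n)=\sum_{i=1}^{n-1}(-1)^{i-1}w_1\otimes\cdots\otimes\delta_2(w_i\square_Cw_{i+1})\otimes\cdots\otimes w_n.$$ The coproduct on $\mathscr{W}_\bullet^{\mathrm{max}}=\bigoplus_n\mathscr{W}_n^{\mathrm{max}}$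 is $\Delta$ on $C$ and, in degree $n\ge1$, $\Delta(\underline w)=\underline w_{(-1)}\otimes\underline w_{(0)}+\underline w_{(0)}\otimes\underline w_{(1)}+\sum_{i=1}^{n-1}(w_1\square_C\cdots\square_Cw_i)\otimes(w_{i+1}\square_C\cdots\square_Cw_n)$ for $\underline w=w_1\square_C\cdots\square_Cw_n$. With this, $(\mathscr{W}_\bullet^{\mathrm{max}},\delta_\bullet)$ is a dg coalgebra with $\underline{\mathscr{W}_1}(\mathscr{W}_\bullet^{\mathrm{max}})=\mathscr{W}_1$. The functor of the last assertion sends a codifferentiable map to its unique extension between the maximal prolongations. *)

(* Defs.v *)
From HB Require Import structures.
From mathcomp Require Import all_boot all_algebra.
From mathcomp Require Import boolp classical_sets.
From mathcomp Require Import freeg.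

Set Implicit Arguments.
Unset Strict Implicit.
Unset Printing Implicit Defensive.

Import GRing.Theory.
Local Open Scope ring_scope.
Local Open Scope classical_set_scope.

Section Span.
Context {k : fieldType} {V : lmodType k}.

(* The smallest subspace containing [A]. *)
Definition span_pred (A : set V) : {pred V} :=
  fun x => `[< forall U : submodClosed V, (forall a, A a -> a \in U) -> x \in U >].

Lemma span_submod A : submod_closed (span_pred A).
Proof.
split=> [|a u v /asboolP hu /asboolP hv]; apply/asboolP => U hU.
  exact: rpred0.
by rewrite rpredD ?rpredZ ?hu ?hv.
Qed.

HB.instance Definition _ A :=
  GRing.isSubmodClosed.Build k V (span_pred A) (span_submod A).

Definition span (A : set V) : submodClosed V := span_pred A.

Lemma span_sub (A : set V) a : A a -> a \in span A.
Proof. by move=> Aa; apply/asboolP => U; apply. Qed.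

Lemma span_min (A : set V) (U : submodClosed V) :
  (forall a, A a -> a \in U) -> {subset span A <= U}.
Proof. by move=> h x /asboolP; apply. Qed.

End Span.

(* Subspaces, quotients and tensor products are first constructed, then accessed
   only through an opaque package of their characteristic properties; this keeps
   unification from unfolding the constructions. *)
Section Subspace.
Context {k : fieldType} {V : lmodType k} (U : submodClosed V).

Record subspace := Subspace {
  subspace_sort : lmodType k;
  subspace_incl : {linear subspace_sort -> V};
  subspace_incl_inj : injective subspace_incl;
  subspace_inclP : forall v, v \in U <-> exists u, subspace_incl u = v }.

Record subsp_model := Subsp { subsp_val : V; _ : subsp_val \in U }.
HB.instance Definition _ := [isSub for subsp_val].
HB.instance Definition _ := [Choice of subsp_model by <:].
HB.instance Definition _ := [SubChoice_isSubLmodule of subsp_model by <:].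

Fact subspace_ex : subspace.
Proof.
apply: (@Subspace subsp_model (val : subsp_model -> V)); first exact: val_inj.
move=> v; split=> [Uv|[u <-]]; last exact: valP.
by exists (Subsp Uv).
Qed.

Definition subsp : lmodType k := subspace_sort subspace_ex.
Definition subsp_incl : {linear subsp -> V} := subspace_incl subspace_ex.
Lemma subsp_incl_inj : injective subsp_incl.
Proof. exact: subspace_incl_inj. Qed.
Lemma subsp_inclP v : v \in U <-> exists u, subsp_incl u = v.
Proof. exact: subspace_inclP. Qed.
End Subspace.

Section Kernel.
Context {k : fieldType} {V W : lmodType k} (f : {linear V -> W}).
Definition lin_ker_pred : {pred V} := fun v => f v == 0.
Lemma lin_ker_submod : submod_closed lin_ker_pred.
Proof.
split=> [|a u v /eqP hu /eqP hv]; rewrite unfold_in /lin_ker_pred ?raddf0 //.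
by rewrite linearP hu hv scaler0 addr0.
Qed.
HB.instance Definition _ :=
  GRing.isSubmodClosed.Build k V lin_ker_pred lin_ker_submod.
Definition lin_ker : submodClosed V := lin_ker_pred.
End Kernel.

Section Quotient.
Context {k : fieldType} {V : lmodType k} (U : submodClosed V).

Record quotient := QuotientSpace {
  quotient_sort : lmodType k;
  quotient_pi : {linear V -> quotient_sort};
  quotient_piP : forall x, exists v, quotient_pi v = x;
  quotient_pi_eq0 : forall v, (quotient_pi v == 0) = (v \in U);
  quotient_lift : forall (W : lmodType k) (f : {linear V -> W}),
    (forall u, u \in U -> f u = 0) -> {linear quotient_sort -> W};
  quotient_liftE : forall W f fU v, @quotient_lift W f fU (quotient_pi v) = f v }.

Definition zmod_pred : {pred V} := fun v => v \in U.
Fact zmod_pred_closed : zmod_closed zmod_pred.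
Proof.
split=> [|u v hu hv]; first exact: rpred0 U.
have: u - v \in U by rewrite -scaleN1r rpredD ?rpredZ.
by [].
Qed.
HB.instance Definition _ := GRing.isZmodClosed.Build V zmod_pred zmod_pred_closed.

Definition quot_model := Quotient.quot zmod_pred.
HB.instance Definition _ := GRing.Zmodule.on quot_model.

Definition quot_scale (a : k) (x : quot_model) : quot_model := \pi_(Quotient.quot zmod_pred)%qT (a *: repr x).

Lemma quot_eqP (x y : V) :
  (\pi_(Quotient.quot zmod_pred)%qT x == \pi_(Quotient.quot zmod_pred)%qT y) = (x - y \in U).
Proof. by rewrite -[RHS]/(x - y \in zmod_pred) Quotient.idealrBE. Qed.

Lemma quot_scale_pi a v :
  quot_scale a (\pi_(Quotient.quot zmod_pred)%qT v) = \pi_(Quotient.quot zmod_pred)%qT (a *: v).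
Proof.
apply/eqP; rewrite /quot_scale quot_eqP -scalerBr rpredZ //.
by rewrite -quot_eqP reprK.
Qed.
Let piD (x y : V) : \pi_(Quotient.quot zmod_pred)%qT x + \pi_(Quotient.quot zmod_pred)%qT y
   = \pi_(Quotient.quot zmod_pred)%qT (x + y) :> Quotient.quot zmod_pred.
Proof. by rewrite !piE. Qed.

Let piW (x : quot_model) : exists v, \pi_(Quotient.quot zmod_pred)%qT v = x.
Proof. by exists (repr (x : Quotient.quot zmod_pred)); exact: reprK. Qed.

Fact quot_scaleA a b x : quot_scale a (quot_scale b x) = quot_scale (a * b) x.
Proof. by have [{}x <-] := piW x; rewrite !quot_scale_pi scalerA. Qed.
Fact quot_scale1 : left_id 1 quot_scale.
Proof. by move=> y; have [x <-] := piW y; rewrite quot_scale_pi scale1r. Qed.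
Fact quot_scaleDr : right_distributive quot_scale +%R.
Proof.
move=> a x y; have [{}x <-] := piW x; have [{}y <-] := piW y.
by rewrite !quot_scale_pi [LHS](congr1 (quot_scale a) (piD x y)) quot_scale_pi scalerDr [RHS]piD.
Qed.
Fact quot_scaleDl v : {morph quot_scale^~ v : a b / a + b}.
Proof. by move=> a b; have [x <-] := piW v; rewrite !quot_scale_pi scalerDl [RHS]piD. Qed.

HB.instance Definition _ := GRing.Zmodule_isLmodule.Build k quot_model
  quot_scaleA quot_scale1 quot_scaleDr quot_scaleDl.

Definition quot_model_pi_fun (v : V) : quot_model := \pi_(Quotient.quot zmod_pred)%qT v.
Fact quot_pi_linear : linear quot_model_pi_fun.
Proof.
by move=> a u v; rewrite /quot_model_pi_fun -piD -quot_scale_pi.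
Qed.
HB.instance Definition _ := GRing.isLinear.Build k V quot_model _ quot_model_pi_fun quot_pi_linear.
Definition quot_model_pi : {linear V -> quot_model} := quot_model_pi_fun.
Lemma quot_model_piE v : quot_model_pi v = \pi_(Quotient.quot zmod_pred)%qT v.
Proof. by []. Qed.

Lemma quot_model_piP (x : quot_model) : exists v, quot_model_pi v = x.
Proof. by exists (repr x); rewrite quot_model_piE; exact: reprK. Qed.

Lemma quot_model_pi_eq0 v : (quot_model_pi v == 0) = (v \in U).
Proof. have -> : 0 = quot_model_pi 0 by rewrite linear0.
by rewrite !quot_model_piE [LHS]quot_eqP subr0. Qed.

Section Lift.
Context {W : lmodType k} (f : {linear V -> W}) (fU : forall u, u \in U -> f u = 0).

Definition quot_model_lift_fun (x : quot_model) : W := f (repr x).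
Lemma quot_model_lift_funE v : quot_model_lift_fun (quot_model_pi v) = f v.
Proof.
apply/eqP; rewrite -subr_eq0 quot_model_piE /quot_model_lift_fun -linearB; apply/eqP/fU.
by rewrite -quot_eqP reprK.
Qed.
Fact quot_lift_linear : linear quot_model_lift_fun.
Proof.
move=> a x y; have [u <-] := quot_model_piP x; have [v <-] := quot_model_piP y.
by rewrite -linearP !quot_model_lift_funE linearP.
Qed.
HB.instance Definition _ := GRing.isLinear.Build k quot_model W _ quot_model_lift_fun quot_lift_linear.
Definition quot_model_lift : {linear quot_model -> W} := quot_model_lift_fun.
Lemma quot_model_liftE v : quot_model_lift (quot_model_pi v) = f v.
Proof. exact: quot_model_lift_funE. Qed.
End Lift.

Fact quotient_ex : quotient.
Proof.
exact: (@QuotientSpace quot_model quot_model_pi quot_model_piP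
  quot_model_pi_eq0 (@quot_model_lift) (@quot_model_liftE)).
Qed.

Definition quotsp : lmodType k := quotient_sort quotient_ex.
Definition quot_pi : {linear V -> quotsp} := quotient_pi quotient_ex.
Lemma quot_piP x : exists v, quot_pi v = x.
Proof. exact: quotient_piP. Qed.
Lemma quot_pi_eq0 v : (quot_pi v == 0) = (v \in U).
Proof. exact: quotient_pi_eq0. Qed.
Definition quot_lift (W : lmodType k) (f : {linear V -> W})
  (fU : forall u, u \in U -> f u = 0) : {linear quotsp -> W} :=
  quotient_lift quotient_ex fU.
Lemma quot_liftE (W : lmodType k) (f : {linear V -> W})
  (fU : forall u, u \in U -> f u = 0) v :
  quot_lift fU (quot_pi v) = f v.
Proof. exact: quotient_liftE. Qed.
End Quotient.

Section LeftInverse.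
Context {k : fieldType} {V W : lmodType k} (f : {linear V -> W}).

Lemma lin_retraction : injective f -> exists g : {linear W -> V}, cancel f g.
Proof.
move=> finj.
pose P : set (set W) := [set U | (forall a u v, U u -> U v -> U (a *: u + v))
                                /\ forall v, U (f v) -> v = 0].
have [|A [[Alin Af] Amax]] := @Zorn_bigcup W P.
  move=> F FP Ftot; split=> [a u v [X FX Xu] [Y FY Yv]|v [X FX]]; last first.
    exact: (FP _ FX).2.
  have [XY|YX] := Ftot _ _ FX FY.
    by exists Y => //; apply: (FP _ FY).1 => //; exact: XY.
  by exists X => //; apply: (FP _ FX).1 => //; exact: YX.
have A0 : A 0.
  apply: contrapT => nA0; apply: (Amax [set x | A x \/ x = 0]).
    split; first by move=> x Ax; left.
    by move=> /(_ 0 (or_intror erefl)).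
  split=> [a u v /= [Au|->] [Av|->]|v /= [/Af //|]].
  - by left; exact: Alin.
  - rewrite addr0.
    have := Alin (a - 1) u u Au Au.
    by rewrite -[in X in _ + X](scale1r u) -scalerDl subrK; left.
  - by rewrite scaler0 add0r; left.
  - by rewrite scaler0 addr0; right.
  - by move=> fv0; apply: finj; rewrite fv0 raddf0.
have AZ a u : A u -> A (a *: u) by move=> Au; have := Alin a u 0 Au A0; rewrite addr0.
have AD u v : A u -> A v -> A (u + v).
  by move=> Au Av; have := Alin 1 u v Au Av; rewrite scale1r.
have ex w : exists v, A (w - f v).
  apply: contrapT => nw.
  apply: (Amax [set x | exists a u, A u /\ x = u + a *: w]).
    split; first by move=> u Au; exists 0, u; rewrite scale0r addr0.
    move=> /(_ w) h; apply: nw; exists 0; rewrite raddf0 subr0; apply: h.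
    by exists 1, 0; rewrite scale1r add0r.
  split=> [a x y [b [u [Au ->]]] [c [v [Av ->]]]|v [a [u [Au fvE]]]].
    exists (a * b + c), (a *: u + v); split; first exact: Alin.
    by rewrite scalerDr scalerA scalerDl addrACA.
  have [a0|an0] := eqVneq a 0.
    by apply: Af; rewrite fvE a0 scale0r addr0.
  exfalso; apply: nw; exists (a^-1 *: v); rewrite linearZ /= fvE scalerDr scalerA.
  rewrite mulVf // scale1r opprD addrCA subrr addr0 -scalerN -scaleN1r.
  by do 2 apply: (AZ).
have /choice[g gP] := ex.
have uniq w v v' : A (w - f v) -> A (w - f v') -> v = v'.
  move=> Av Av'; apply/eqP; rewrite -subr_eq0; apply/eqP/Af.
  have := AD _ _ Av' (AZ (-1) _ Av).
  by rewrite scaleN1r opprB addrC addrA subrK -linearB.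
have glin : linear g.
  move=> a u v; apply: (uniq (a *: u + v)); first exact: gP.
  have := Alin a _ _ (gP u) (gP v).
  by rewrite linearP scalerBr opprD addrACA.
pose G := GRing.isLinear.Build k W V _ g glin.
exists (HB.pack_for {linear W -> V} g G) => v /=; apply: (uniq (f v)); first exact: gP.
by rewrite subrr.
Qed.

(* A linear left inverse of [f], chosen once and for all; zero if there is none. *)
Definition lretr : {linear W -> V} :=
  if pselect (exists g : {linear W -> V}, cancel f g) is left h then projT1 (cid h)
  else (\0 : {linear W -> V}).

Lemma lretrK : injective f -> cancel f lretr.
Proof.
move=> finj; rewrite /lretr; case: pselect => [h|[]]; last exact: lin_retraction.
exact: projT2 (cid h).
Qed.
End LeftInverse.

Section Tensor.
Context {k : fieldType}.
Implicit Types U V W : lmodType k.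

Definition mklin V W (f : V -> W) (h : linear f) : {linear V -> W} :=
  HB.pack_for {linear V -> W} f (GRing.isLinear.Build k V W _ f h).

Section FreeLift.
Context (K : choiceType) (M : lmodType k) (f : K -> M).
Let fgliftB : {morph (fglift f : {freeg K / k} -> M) : x y / x - y}.
Proof. exact: lift_is_additive. Qed.
Let fglift0 : fglift f (0 : {freeg K / k}) = 0.
Proof. by have := fgliftB 0 0; rewrite !subrr. Qed.
Let fgliftD : {morph (fglift f : {freeg K / k} -> M) : x y / x + y}.
Proof.
move=> x y; have := fgliftB 0 y; rewrite fglift0 !sub0r => fN.
by rewrite -[y]opprK fgliftB fN !opprK.
Qed.
Let freegZU (a b : k) (z : K) :
  a *: << b *g z >> = << a * b *g z >> :> {freeg K / k}.
Proof. by apply/eqP/freeg_eqP => t; rewrite coeffZ !coeffU mulrA. Qed.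

Fact fglift_linear : linear (fglift f : {freeg K / k} -> M).
Proof.
move=> a x y; rewrite fgliftD; congr (_ + _).
rewrite -(freeg_sumE x); elim: (dom x) => [|z s IH].
  by rewrite !big_nil scaler0 fglift0 scaler0.
by rewrite !big_cons scalerDr !fgliftD IH freegZU !liftU scalerDr scalerA.
Qed.
Definition free_lift : {linear {freeg K / k} -> M} := mklin fglift_linear.
End FreeLift.

Section Def.
Context (V W : lmodType k).

Definition bilin (U : lmodType k) (f : V -> W -> U) :=
  (forall w, linear (f^~ w)) /\ (forall v, linear (f v)).

Record tensor := Tensor {
  tensor_sort : lmodType k;
  tensor_pure : V -> W -> tensor_sort;
  tensor_bilin : bilin tensor_pure;
  tensor_ind : forall P : tensor_sort -> Prop, P 0 ->
    (forall a x y, P x -> P y -> P (a *: x + y)) ->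
    (forall v w, P (tensor_pure v w)) -> forall x, P x;
  tensor_lift : forall (U : lmodType k) (f : V -> W -> U),
    bilin f -> {linear tensor_sort -> U};
  tensor_liftE : forall U f hf v w, @tensor_lift U f hf (tensor_pure v w) = f v w }.

Definition tensor_rel : set {freeg (V * W)%type / k} := [set x |
  (exists a v v' w,
     x = << (a *: v + v', w) >> - (a *: << (v, w) >> + << (v', w) >>)) \/
  (exists a v w w',
     x = << (v, a *: w + w') >> - (a *: << (v, w) >> + << (v, w') >>))].

Let tens0 : lmodType k := quotsp (span tensor_rel).
Let pure0 (v : V) (w : W) : tens0 := quot_pi (span tensor_rel) << (v, w) >>.

Fact tensor_model_bilin : bilin pure0.
Proof.
split=> [w a v v'|v a w w']; apply/eqP;
  rewrite -subr_eq0 /pure0 -linearP -linearB quot_pi_eq0; apply: span_sub.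
  by left; exists a, v, v', w.
by right; exists a, v, w, w'.
Qed.

Fact tensor_model_ind (P : tens0 -> Prop) : P 0 ->
  (forall a x y, P x -> P y -> P (a *: x + y)) ->
  (forall v w, P (pure0 v w)) -> forall x, P x.
Proof.
move=> P0 PD Pp x; have [u <-] := quot_piP x.
rewrite -(freeg_sumE u) raddf_sum; elim: (dom u) => [|[v w] s IH].
  by rewrite big_nil.
rewrite big_cons.
have -> : << coeff (v, w) u *g (v, w) >> = coeff (v, w) u *: << (v, w) >>
    :> {freeg (V * W)%type / k}.
  by apply/eqP/freeg_eqP => t; rewrite coeffZ !coeffU mul1r.
have := PD (coeff (v, w) u) _ _ (Pp v w) IH.
by rewrite /pure0 -linearZ.
Qed.

Section Lift.
Context (U : lmodType k) (f : V -> W -> U) (hf : bilin f).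
Fact tensor_model_lift_subproof u : u \in span tensor_rel ->
  free_lift (fun x => f x.1 x.2) u = 0.
Proof.
move=> /(span_min (U := lin_ker (free_lift (fun x => f x.1 x.2)))) h.
apply/eqP; apply: h => {u} x [] [a [v [v' [w ->]]]]; apply/eqP;
  rewrite linearB linearP /= !liftU !scale1r.
  by rewrite (hf.1 w) subrr.
by rewrite (hf.2 v) subrr.
Qed.
Definition tensor_model_lift : {linear tens0 -> U} := quot_lift tensor_model_lift_subproof.
Fact tensor_model_liftE v w : tensor_model_lift (pure0 v w) = f v w.
Proof. by rewrite [LHS]quot_liftE /= liftU scale1r. Qed.
End Lift.

Fact tensor_ex : tensor.
Proof.
exact: (@Tensor tens0 pure0 tensor_model_bilin tensor_model_ind
  (@tensor_model_lift) (@tensor_model_liftE)).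
Qed.

Definition tens : lmodType k := tensor_sort tensor_ex.
Definition pure : V -> W -> tens := tensor_pure tensor_ex.
Lemma pure_linearl w : linear (pure^~ w).
Proof. exact: (tensor_bilin tensor_ex).1. Qed.
Lemma pure_linearr v : linear (pure v).
Proof. exact: (tensor_bilin tensor_ex).2. Qed.

Lemma tens_ext (U : lmodType k) (f g : {linear tens -> U}) :
  (forall v w, f (pure v w) = g (pure v w)) -> f =1 g.
Proof.
move=> h; apply: tensor_ind => //; first by rewrite !linear0.
by move=> a x y hx hy; rewrite !linearP hx hy.
Qed.

Definition tens_lift (U : lmodType k) (f : V -> W -> U) (hf : bilin f) :
  {linear tens -> U} := tensor_lift tensor_ex hf.
Lemma tens_liftE (U : lmodType k) (f : V -> W -> U) (hf : bilin f) v w :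
  tens_lift hf (pure v w) = f v w.
Proof. exact: tensor_liftE. Qed.

End Def.
End Tensor.

Notation "V ⊗ W" := (tens V W) (at level 38, left associativity) : type_scope.
Notation idl := (idfun : {linear _ -> _}).

Section TensorMaps.
Context {k : fieldType}.
Implicit Types U V W : lmodType k.

Section Map.
Context {V V' W W' : lmodType k} (f : {linear V -> V'}) (g : {linear W -> W'}).
Fact tmap_bilin : bilin (fun v w => pure (f v) (g w)).
Proof.
by split=> [w|v] a x y; rewrite linearP ?pure_linearl ?pure_linearr.
Qed.
Definition tmap : {linear V ⊗ W -> V' ⊗ W'} := tens_lift tmap_bilin.
Lemma tmapE v w : tmap (pure v w) = pure (f v) (g w).
Proof. exact: tens_liftE. Qed.
End Map.

Lemma tmap_comp {V V' V'' W W' W'' : lmodType k}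
    (f' : {linear V' -> V''}) (f : {linear V -> V'})
    (g' : {linear W' -> W''}) (g : {linear W -> W'}) x :
  tmap f' g' (tmap f g x) = tmap (f' \o f) (g' \o g) x.
Proof.
apply: (tens_ext (f := tmap f' g' \o tmap f g)) => v w.
by rewrite /= !tmapE.
Qed.

Lemma eq_tmap {V V' W W' : lmodType k} (f f' : {linear V -> V'})
    (g g' : {linear W -> W'}) : f =1 f' -> g =1 g' -> tmap f g =1 tmap f' g'.
Proof. by move=> ff' gg'; apply: tens_ext => v w; rewrite !tmapE ff' gg'. Qed.

Lemma tmap_id {V W : lmodType k} : tmap idl idl =1 id :> (V ⊗ W -> V ⊗ W).
Proof. by apply: (tens_ext (g := idl)) => v w; rewrite tmapE. Qed.

Section Assoc.
Context {U V W : lmodType k}.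

Fact tassoc_bilin1 (w : W) : bilin (fun (u : U) (v : V) => pure u (pure v w)).
Proof.
by split=> [v|u] a x y; rewrite ?pure_linearl ?pure_linearr.
Qed.
Fact tassoc_bilin : bilin (fun (x : U ⊗ V) (w : W) => tens_lift (tassoc_bilin1 w) x).
Proof.
split=> [w|]; first exact: linearP.
move=> x a w w'; move: x.
pose F := tens_lift (tassoc_bilin1 w); pose F' := tens_lift (tassoc_bilin1 w').
apply: (tens_ext (g := a \*: F \+ F')) => u v.
by rewrite /= !tens_liftE !pure_linearr.
Qed.
Definition tassoc : {linear (U ⊗ V) ⊗ W -> U ⊗ (V ⊗ W)} := tens_lift tassoc_bilin.
Lemma tassocE u v w : tassoc (pure (pure u v) w) = pure u (pure v w).
Proof. by rewrite /tassoc !tens_liftE. Qed.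

Fact tassocV_bilin1 (u : U) : bilin (fun (v : V) (w : W) => pure (pure u v) w).
Proof.
by split=> [w|v] a x y; rewrite ?pure_linearl ?pure_linearr ?pure_linearl.
Qed.
Fact tassocV_bilin : bilin (fun (u : U) (x : V ⊗ W) => tens_lift (tassocV_bilin1 u) x).
Proof.
split=> [|u]; last exact: linearP.
move=> x a u u'; move: x.
pose F := tens_lift (tassocV_bilin1 u); pose F' := tens_lift (tassocV_bilin1 u').
apply: (tens_ext (g := a \*: F \+ F')) => v w.
by rewrite /= !tens_liftE !pure_linearl.
Qed.
Definition tassocV : {linear U ⊗ (V ⊗ W) -> (U ⊗ V) ⊗ W} := tens_lift tassocV_bilin.
Lemma tassocVE u v w : tassocV (pure u (pure v w)) = pure (pure u v) w.
Proof. by rewrite /tassocV !tens_liftE. Qed.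
End Assoc.

Lemma tens3_ext {U V W T : lmodType k} (f g : {linear U ⊗ (V ⊗ W) -> T}) :
  (forall u v w, f (pure u (pure v w)) = g (pure u (pure v w))) -> f =1 g.
Proof.
move=> h; apply: tens_ext => u.
apply: (tens_ext (f := f \o mklin (pure_linearr u))
                 (g := g \o mklin (pure_linearr u))) => v w.
exact: h.
Qed.

Lemma tens3l_ext {U V W T : lmodType k} (f g : {linear (U ⊗ V) ⊗ W -> T}) :
  (forall u v w, f (pure (pure u v) w) = g (pure (pure u v) w)) -> f =1 g.
Proof.
move=> h; apply: tens_ext => x w; move: x.
apply: (tens_ext (f := f \o mklin (pure_linearl w))
                 (g := g \o mklin (pure_linearl w))) => u v.
exact: h.
Qed.

Lemma tassocK {U V W : lmodType k} : cancel (@tassoc U V W) tassocV.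
Proof.
apply: (tens3l_ext (f := tassocV \o tassoc) (g := idl)) => u v w.
by rewrite /= tassocE tassocVE.
Qed.
Lemma tassocVK {U V W : lmodType k} : cancel (@tassocV U V W) tassoc.
Proof.
apply: (tens3_ext (f := tassoc \o tassocV) (g := idl)) => u v w.
by rewrite /= tassocVE tassocE.
Qed.

Lemma tassoc_nat {U U' V V' W W' : lmodType k} (f : {linear U -> U'})
    (g : {linear V -> V'}) (h : {linear W -> W'}) x :
  tassoc (tmap (tmap f g) h x) = tmap f (tmap g h) (tassoc x).
Proof.
move: x; apply: (tens3l_ext (f := tassoc \o tmap (tmap f g) h)
                   (g := tmap f (tmap g h) \o tassoc)) => u v w.
by rewrite /= !(tmapE, tassocE).
Qed.

Lemma tassocV_nat {U U' V V' W W' : lmodType k} (f : {linear U -> U'})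
    (g : {linear V -> V'}) (h : {linear W -> W'}) x :
  tassocV (tmap f (tmap g h) x) = tmap (tmap f g) h (tassocV x).
Proof.
move: x; apply: (tens3_ext (f := tassocV \o tmap f (tmap g h))
                   (g := tmap (tmap f g) h \o tassocV)) => u v w.
by rewrite /= !(tmapE, tassocVE).
Qed.

Lemma tmap_inj {V V' W W' : lmodType k} (f : {linear V -> V'})
    (g : {linear W -> W'}) : injective f -> injective g -> injective (tmap f g).
Proof.
move=> finj ginj; apply: (can_inj (g := tmap (lretr f) (lretr g))) => x.
rewrite tmap_comp -[RHS]tmap_id; apply: eq_tmap => y /=; exact: lretrK.
Qed.

(* [contrl e] is $e \otimes \mathrm{id}$ followed by $k \otimes V \cong V$. *)
Section Contract.
Context {C V : lmodType k} (e : {linear C -> k^o}).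
Fact contrl_bilin : bilin (fun (c : C) (v : V) => e c *: v).
Proof.
split=> [v|c] a x y; first by rewrite linearP scalerDl scalerA.
by rewrite scalerDr !scalerA mulrC.
Qed.
Definition contrl : {linear C ⊗ V -> V} := tens_lift contrl_bilin.
Lemma contrlE c v : contrl (pure c v) = e c *: v.
Proof. exact: tens_liftE. Qed.
Fact contrr_bilin : bilin (fun (v : V) (c : C) => e c *: v).
Proof. by split=> x; [exact: contrl_bilin.2|exact: contrl_bilin.1]. Qed.
Definition contrr : {linear V ⊗ C -> V} := tens_lift contrr_bilin.
Lemma contrrE c v : contrr (pure v c) = e c *: v.
Proof. exact: tens_liftE. Qed.
End Contract.

Lemma contrl_nat {C V W : lmodType k} (e : {linear C -> k^o}) (f : {linear V -> W}) x :
  contrl e (tmap idl f x) = f (contrl e x).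
Proof.
move: x; apply: (tens_ext (f := contrl e \o tmap idl f) (g := f \o contrl e)).
by move=> c v; rewrite /= tmapE !contrlE linearZ.
Qed.
Lemma contrr_nat {C V W : lmodType k} (e : {linear C -> k^o}) (f : {linear V -> W}) x :
  contrr e (tmap f idl x) = f (contrr e x).
Proof.
move: x; apply: (tens_ext (f := contrr e \o tmap f idl) (g := f \o contrr e)).
by move=> c v; rewrite /= tmapE !contrrE linearZ.
Qed.

End TensorMaps.

Section LinMisc.
Context {k : fieldType}.

Lemma lin_inj {V W : lmodType k} (f : {linear V -> W}) :
  (forall x, f x = 0 -> x = 0) -> injective f.
Proof.
move=> h x y fxy; apply/eqP; rewrite -subr_eq0; apply/eqP/h.
by rewrite linearB fxy subrr.
Qed.

Lemma pure0 {V W : lmodType k} (v : V) : pure v (0 : W) = 0.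
Proof. exact: linear0 (mklin (pure_linearr v)). Qed.
Lemma pure0l {V W : lmodType k} (w : W) : pure (0 : V) w = 0.
Proof. exact: linear0 (mklin (pure_linearl w)). Qed.

Lemma linear_eq {V W : lmodType k} (f g : {linear V -> W}) : f =1 g -> f = g.
Proof.
case: f g => [f cf] [g cg] /= fg.
have {fg}e : f = g by apply: funext.
case: g / e cg => cg; congr (GRing.Linear.Pack _).
case: cf cg => [[a] [b]] [[c] [e]].
by congr GRing.Linear.Class; congr GRing.isNmodMorphism.Axioms_ || congr GRing.isScalable.Axioms_;
  apply: Prop_irrelevance.
Qed.

Lemma tmap0r {V V' W W' : lmodType k} (f : {linear V -> V'}) (g : {linear W -> W'}) x :
  (forall w, g w = 0) -> tmap f g x = 0.
Proof.
move=> g0; move: x; apply: (tens_ext (g := (\0 : {linear V ⊗ W -> V' ⊗ W'}))) => v w.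
by rewrite tmapE g0 pure0.
Qed.
Lemma tmap0l {V V' W W' : lmodType k} (f : {linear V -> V'}) (g : {linear W -> W'}) x :
  (forall v, f v = 0) -> tmap f g x = 0.
Proof.
move=> f0; move: x; apply: (tens_ext (g := (\0 : {linear V ⊗ W -> V' ⊗ W'}))) => v w.
by rewrite tmapE f0 pure0l.
Qed.

Lemma tmapDr {V V' W W' : lmodType k} (f : {linear V -> V'})
    (g g1 g2 : {linear W -> W'}) x : (forall w, g w = g1 w + g2 w) ->
  tmap f g x = tmap f g1 x + tmap f g2 x.
Proof.
move=> gD; move: x; apply: (tens_ext (g := tmap f g1 \+ tmap f g2)) => v w.
rewrite /= !tmapE gD; exact: linearD (mklin (pure_linearr (f v))) _ _.
Qed.
End LinMisc.

Section Coalgebra.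
Context (k : fieldType).

Record coalg := Coalg {
  coalg_sort :> lmodType k;
  comul : {linear coalg_sort -> coalg_sort ⊗ coalg_sort};
  counit : {linear coalg_sort -> k^o};
  comulA : forall c, tassoc (tmap comul idl (comul c)) = tmap idl comul (comul c);
  counit_l : forall c, contrl counit (comul c) = c;
  counit_r : forall c, contrr counit (comul c) = c }.

Record bicomod (C : coalg) := Bicomod {
  bicomod_sort :> lmodType k;
  lcoact : {linear bicomod_sort -> C ⊗ bicomod_sort};
  rcoact : {linear bicomod_sort -> bicomod_sort ⊗ C};
  lcoactA : forall w,
    tassoc (tmap (comul C) idl (lcoact w)) = tmap idl lcoact (lcoact w);
  lcoact1 : forall w, contrl (counit C) (lcoact w) = w;
  rcoactA : forall w,
    tassoc (tmap rcoact idl (rcoact w)) = tmap idl (comul C) (rcoact w);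
  rcoact1 : forall w, contrr (counit C) (rcoact w) = w;
  lrcoact : forall w,
    tassoc (tmap lcoact idl (rcoact w)) = tmap idl rcoact (lcoact w) }.

Definition coderivation (C : coalg) (W : bicomod C) (d : {linear W -> C}) :=
  forall w, comul C (d w) = tmap d idl (rcoact W w) + tmap idl d (lcoact W w).

Record focc := Focc {
  focc_base : coalg;
  focc_mod : bicomod focc_base;
  focc_d : {linear focc_mod -> focc_base};
  focc_coder : coderivation focc_d;
  focc_inj : injective (fun w => tmap idl focc_d (lcoact focc_mod w)) }.

End Coalgebra.

Section LinImage.
Context {k : fieldType} {V W : lmodType k} (f : {linear V -> W}).
Definition lin_im_pred : {pred W} := fun w => `[< exists v, f v = w >].
Lemma lin_im_submod : submod_closed lin_im_pred.
Proof.
split=> [|a u v /asboolP[x <-] /asboolP[y <-]]; apply/asboolP.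
  by exists 0; rewrite linear0.
by exists (a *: x + y); rewrite linearP.
Qed.
HB.instance Definition _ :=
  GRing.isSubmodClosed.Build k W lin_im_pred lin_im_submod.
Definition lin_im : submodClosed W := lin_im_pred.
Lemma lin_imP w : reflect (exists v, f v = w) (w \in lin_im).
Proof. exact: asboolP. Qed.
End LinImage.

Section Universal.
Context {k : fieldType} (C : coalg k).

(* The underlying space $(C \otimes C)/\mathrm{im}(\Delta)$ of the universal FOCC,
   with its coactions and its coderivation. *)
Definition ufocc : lmodType k := quotsp (lin_im (comul C)).
Definition ufocc_pi : {linear C ⊗ C -> ufocc} := quot_pi (lin_im (comul C)).

Lemma ufocc_pi_comul c : ufocc_pi (comul C c) = 0.
Proof. by apply/eqP; rewrite quot_pi_eq0; apply/lin_imP; exists c. Qed.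

Lemma ufocc_pi_eq0 x : ufocc_pi x = 0 -> exists c, comul C c = x.
Proof. by move/eqP; rewrite quot_pi_eq0 => /lin_imP. Qed.

Fact ufocc_lcoact_subproof u : u \in lin_im (comul C) ->
  (tmap idl ufocc_pi \o tassoc \o tmap (comul C) idl) u = 0.
Proof.
move=> /lin_imP[c <-] /=; rewrite comulA tmap_comp.
by apply: tmap0r => x /=; rewrite ufocc_pi_comul.
Qed.
Definition ufocc_lcoact : {linear ufocc -> C ⊗ ufocc} := quot_lift ufocc_lcoact_subproof.

Fact ufocc_rcoact_subproof u : u \in lin_im (comul C) ->
  (tmap ufocc_pi idl \o tassocV \o tmap idl (comul C)) u = 0.
Proof.
move=> /lin_imP[c <-] /=; rewrite -comulA tassocK tmap_comp.
by apply: tmap0l => x /=; rewrite ufocc_pi_comul.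
Qed.
Definition ufocc_rcoact : {linear ufocc -> ufocc ⊗ C} := quot_lift ufocc_rcoact_subproof.

Fact ufocc_d_subproof u : u \in lin_im (comul C) ->
  (contrl (counit C) \- contrr (counit C)) u = 0.
Proof. by move=> /lin_imP[c <-] /=; rewrite counit_l counit_r subrr. Qed.
Definition ufocc_d : {linear ufocc -> C} := quot_lift ufocc_d_subproof.

(* The canonical map $\varphi(w) = [w_{(-1)} \otimes \delta(w_{(0)})]$. *)
Definition ufocc_map (W : bicomod C) (d : {linear W -> C}) : {linear W -> ufocc} :=
  ufocc_pi \o tmap idl d \o lcoact W.

Section Map.
Context (W : bicomod C) (d : {linear W -> C}) (hd : coderivation d).

Lemma counit_coder w : counit C (d w) = 0.
Proof.
have h1 : contrl (counit C) (tmap idl d (lcoact W w)) = d w.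
  by rewrite contrl_nat lcoact1.
have h2 : contrr (counit C) (tmap d idl (rcoact W w)) = d w.
  by rewrite contrr_nat rcoact1.
have e1 := congr1 (contrl (counit C)) (hd w).
rewrite counit_l linearD h1 in e1.
have h3 : contrl (counit C) (tmap d idl (rcoact W w)) = 0.
  by apply: (addIr (d w)); rewrite -e1 add0r.
have sw (x : C ⊗ C) : counit C (contrl (counit C) x) = counit C (contrr (counit C) x).
  move: x; apply: (tens_ext (f := counit C \o contrl (counit C))
     (g := counit C \o contrr (counit C))) => a b.
  by rewrite /= contrlE contrrE !linearZ; exact: mulrC.
by rewrite -h2 -sw h3 linear0.
Qed.

Lemma ufocc_d_map w : ufocc_d (ufocc_map d w) = d w.
Proof.
rewrite quot_liftE /= contrl_nat lcoact1 [X in _ - X](_ : _ = 0) ?subr0 //.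
move: (lcoact W w); apply: (tens_ext (f := contrr (counit C) \o tmap idl d)
  (g := (\0 : {linear C ⊗ W -> C}))) => c v.
by rewrite /= tmapE contrrE counit_coder scale0r.
Qed.

Lemma ufocc_map_lcoact w :
  ufocc_lcoact (ufocc_map d w) = tmap idl (ufocc_map d) (lcoact W w).
Proof.
rewrite quot_liftE /=.
have -> x : tmap (comul C) idl (tmap idl d x) =
    tmap (tmap idl idl) d (tmap (comul C) idl x).
  by rewrite !tmap_comp; apply: eq_tmap => y //=; rewrite tmap_id.
by rewrite tassoc_nat lcoactA !tmap_comp; apply: eq_tmap.
Qed.

Lemma ufocc_map_rcoact w :
  ufocc_rcoact (ufocc_map d w) = tmap (ufocc_map d) idl (rcoact W w).
Proof.
rewrite quot_liftE /=.
have -> : tmap idl (comul C) (tmap idl d (lcoact W w)) =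
    tmap idl (tmap d idl) (tmap idl (rcoact W) (lcoact W w)) +
    tmap idl (tmap idl d) (tmap idl (lcoact W) (lcoact W w)).
  by rewrite !tmap_comp; apply: tmapDr => v /=; rewrite hd.
rewrite -lrcoact -lcoactA !linearD !tassocV_nat !tassocK !tmap_comp /=.
rewrite [X in _ + X](_ : _ = 0); last first.
  by apply: tmap0l => c /=; rewrite tmap_id ufocc_pi_comul.
by rewrite addr0; apply: eq_tmap.
Qed.
End Map.
End Universal.

Section ReducedFOCC.
Context {k : fieldType} (C : coalg k) (W : bicomod C) (d : {linear W -> C}).
Hypothesis hd : coderivation d.

Lemma ufocc_map_inj : injective (fun w => tmap idl d (lcoact W w)) ->
  injective (ufocc_map d).
Proof.
move=> inj; apply: lin_inj => x /ufocc_pi_eq0[c hc].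
have c0 : c = 0.
  rewrite -[c](@counit_r _ C) hc /=; move: (lcoact W x).
  apply: (tens_ext (f := contrr (counit C) \o tmap idl d) (g := (\0 : {linear C ⊗ W -> C}))).
  by move=> a v; rewrite /= tmapE contrrE counit_coder ?scale0r.
by apply: inj; rewrite /= in hc; rewrite -hc c0 !linear0.
Qed.

Let K := lin_ker (ufocc_map d).
Let pi : {linear W -> quotsp K} := quot_pi K.

Fact focc_red_map_subproof u : u \in K -> ufocc_map d u = 0.
Proof. by move/eqP. Qed.
Definition focc_red_map : {linear quotsp K -> ufocc C} := quot_lift focc_red_map_subproof.

Lemma focc_red_map_inj : injective focc_red_map.
Proof.
apply: lin_inj => x; have [u <-] := quot_piP x.
by rewrite quot_liftE => h; apply/eqP; rewrite quot_pi_eq0; apply/eqP.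
Qed.

Let red_map_pi : focc_red_map \o pi =1 ufocc_map d.
Proof. by move=> w; rewrite /= quot_liftE. Qed.

Fact focc_red_lcoact_subproof u : u \in K -> (tmap idl pi \o lcoact W) u = 0.
Proof.
move=> /focc_red_map_subproof hu.
apply: (tmap_inj (f := idl) (g := focc_red_map)) => //; first exact: focc_red_map_inj.
rewrite /= tmap_comp linear0 (eq_tmap (f' := idl) (g' := ufocc_map d)) //.
by rewrite -ufocc_map_lcoact // hu linear0.
Qed.
Definition focc_red_lcoact : {linear quotsp K -> C ⊗ quotsp K} :=
  quot_lift focc_red_lcoact_subproof.

Fact focc_red_rcoact_subproof u : u \in K -> (tmap pi idl \o rcoact W) u = 0.
Proof.
move=> /focc_red_map_subproof hu.
apply: (tmap_inj (f := focc_red_map) (g := idl)) => //; first exact: focc_red_map_inj.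
rewrite /= tmap_comp linear0 (eq_tmap (f' := ufocc_map d) (g' := idl)) //.
by rewrite -ufocc_map_rcoact // hu linear0.
Qed.
Definition focc_red_rcoact : {linear quotsp K -> quotsp K ⊗ C} :=
  quot_lift focc_red_rcoact_subproof.

Fact focc_red_d_subproof u : u \in K -> d u = 0.
Proof. by move=> /focc_red_map_subproof hu; rewrite -(ufocc_d_map hd) hu linear0. Qed.
Definition focc_red_d : {linear quotsp K -> C} := quot_lift focc_red_d_subproof.

Let lpi w : focc_red_lcoact (pi w) = tmap idl pi (lcoact W w).
Proof. exact: quot_liftE. Qed.
Let rpi w : focc_red_rcoact (pi w) = tmap pi idl (rcoact W w).
Proof. exact: quot_liftE. Qed.
Let dpi w : focc_red_d (pi w) = d w.
Proof. exact: quot_liftE. Qed.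

Fact focc_red_lcoactA w : tassoc (tmap (comul C) idl (focc_red_lcoact w)) =
  tmap idl focc_red_lcoact (focc_red_lcoact w).
Proof.
have [v <-] := quot_piP w; rewrite lpi tmap_comp.
have -> : tmap (comul C \o idl) (idl \o pi) (lcoact W v) =
    tmap (tmap idl idl) pi (tmap (comul C) idl (lcoact W v)).
  by rewrite tmap_comp; apply: eq_tmap => // c; rewrite /= tmap_id.
rewrite tassoc_nat lcoactA !tmap_comp; apply: eq_tmap => // y.
by rewrite /= lpi.
Qed.

Fact focc_red_rcoactA w : tassoc (tmap focc_red_rcoact idl (focc_red_rcoact w)) =
  tmap idl (comul C) (focc_red_rcoact w).
Proof.
have [v <-] := quot_piP w; rewrite rpi !tmap_comp.
have -> : tmap (focc_red_rcoact \o pi) (idl \o idl) (rcoact W v) =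
    tmap (tmap pi idl) idl (tmap (rcoact W) idl (rcoact W v)).
  by rewrite tmap_comp; apply: eq_tmap => // c; rewrite /= rpi.
rewrite tassoc_nat rcoactA !tmap_comp; apply: eq_tmap => // y.
by rewrite /= tmap_id.
Qed.

Fact focc_red_lrcoact w : tassoc (tmap focc_red_lcoact idl (focc_red_rcoact w)) =
  tmap idl focc_red_rcoact (focc_red_lcoact w).
Proof.
have [v <-] := quot_piP w; rewrite lpi rpi !tmap_comp.
have -> : tmap (focc_red_lcoact \o pi) (idl \o idl) (rcoact W v) =
    tmap (tmap idl pi) idl (tmap (lcoact W) idl (rcoact W v)).
  by rewrite tmap_comp; apply: eq_tmap => // c; rewrite /= lpi.
rewrite tassoc_nat lrcoact !tmap_comp; apply: eq_tmap => // y.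
by rewrite /= rpi.
Qed.

Fact focc_red_lcoact1 w : contrl (counit C) (focc_red_lcoact w) = w.
Proof. by have [v <-] := quot_piP w; rewrite lpi contrl_nat lcoact1. Qed.
Fact focc_red_rcoact1 w : contrr (counit C) (focc_red_rcoact w) = w.
Proof. by have [v <-] := quot_piP w; rewrite rpi contrr_nat rcoact1. Qed.

Definition focc_red_mod : bicomod C := Bicomod focc_red_lcoactA focc_red_lcoact1
  focc_red_rcoactA focc_red_rcoact1 focc_red_lrcoact.

Fact focc_red_coder : coderivation (W := focc_red_mod) focc_red_d.
Proof.
move=> w; have [v <-] := quot_piP w; rewrite /= dpi hd lpi rpi !tmap_comp.
by congr (_ + _); apply: eq_tmap => // y; rewrite /= dpi.
Qed.

Fact focc_red_inj : injective (fun w => tmap idl focc_red_d (lcoact focc_red_mod w)).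
Proof.
apply: (lin_inj (f := tmap idl focc_red_d \o lcoact focc_red_mod)) => w.
have [v <-] := quot_piP w; rewrite /= lpi tmap_comp => h.
apply/eqP; rewrite quot_pi_eq0; apply/eqP; rewrite /ufocc_map /=.
rewrite (eq_tmap (f' := idl \o idl) (g' := focc_red_d \o pi)) ?h ?linear0 //.
by move=> y; rewrite /= dpi.
Qed.

(* $W/\ker(\varphi)$ with the induced coderivation. *)
Definition focc_red : focc k := Focc focc_red_coder focc_red_inj.

End ReducedFOCC.

Section DG.
Context (k : fieldType).

(* The coproduct is given by its components $D_n \to D_i \otimes D_j$, which vanish
   unless $i + j = n$. The counit of a nonnegatively graded coalgebra whose
   coproduct is graded vanishes in positive degrees, so only its restriction to
   $D_0$ is recorded; likewise the differential is zero on $D_0$. *)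
Record dgdata := DGData {
  dg_sp :> nat -> lmodType k;
  dg_comul : forall n i j, {linear dg_sp n -> dg_sp i ⊗ dg_sp j};
  dg_counit : {linear dg_sp 0 -> k^o};
  dg_d : forall n, {linear dg_sp n.+1 -> dg_sp n} }.

Record dg_axioms (D : dgdata) : Prop := DGAxioms {
  dg_comul_deg : forall n i j (x : D n), (i + j)%N != n -> dg_comul D n i j x = 0;
  dg_comulA : forall n i j l (x : D n),
    tassoc (tmap (dg_comul D (i + j) i j) idl (dg_comul D n (i + j) l x)) =
    tmap idl (dg_comul D (j + l) j l) (dg_comul D n i (j + l) x);
  dg_counit_l : forall n (x : D n), contrl (dg_counit D) (dg_comul D n 0 n x) = x;
  dg_counit_r : forall n (x : D n), contrr (dg_counit D) (dg_comul D n n 0 x) = x;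
  dg_dd : forall n (x : D n.+2), dg_d D n (dg_d D n.+1 x) = 0;
  dg_coder : forall n i j (x : D n.+1),
    dg_comul D n i j (dg_d D n x) =
      tmap (dg_d D i) idl (dg_comul D n.+1 i.+1 j x) +
      (-1) ^+ i *: tmap idl (dg_d D j) (dg_comul D n.+1 i j.+1 x) }.

Record dgcoalg := DGCoalg { dgcoalg_data :> dgdata; dgcoalgP : dg_axioms dgcoalg_data }.

Section Degree01.
Variable D : dgcoalg.

Definition dg_deg0 : coalg k := @Coalg k (D 0) (dg_comul D 0 0 0) (dg_counit D)
  (@dg_comulA D (dgcoalgP D) 0 0 0 0)
  (@dg_counit_l D (dgcoalgP D) 0) (@dg_counit_r D (dgcoalgP D) 0).

Definition dg_deg1 : bicomod dg_deg0 :=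
  @Bicomod k dg_deg0 (D 1) (dg_comul D 1 0 1) (dg_comul D 1 1 0)
  (@dg_comulA D (dgcoalgP D) 1 0 0 1)
  (@dg_counit_l D (dgcoalgP D) 1)
  (@dg_comulA D (dgcoalgP D) 1 1 0 0)
  (@dg_counit_r D (dgcoalgP D) 1)
  (@dg_comulA D (dgcoalgP D) 1 0 1 0).

Fact dg_deg1_coder : coderivation (W := dg_deg1) (dg_d D 0).
Proof.
move=> x; rewrite [LHS](@dg_coder D (dgcoalgP D) 0 0 0).
by rewrite expr0 scale1r.
Qed.

(* $\underline{\mathscr{W}_1}(D_\bullet)$ *)
Definition dg_focc : focc k := focc_red dg_deg1_coder.
End Degree01.
End DG.

Record category := Category {
  ob :> Type;
  hom : ob -> ob -> Type;
  idm : forall X, hom X X;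
  comp : forall X Y Z, hom Y Z -> hom X Y -> hom X Z;
  compf1 : forall X Y (f : hom X Y), comp f (idm X) = f;
  comp1f : forall X Y (f : hom X Y), comp (idm Y) f = f;
  compfA : forall X Y Z T (h : hom Z T) (g : hom Y Z) (f : hom X Y),
    comp h (comp g f) = comp (comp h g) f }.

Record functor_axioms (A B : category) (F : A -> B)
    (Fmap : forall X Y, hom X Y -> hom (F X) (F Y)) : Prop := FunctorAxioms {
  fmap1_axiom : forall X, Fmap X X (idm X) = idm (F X);
  fmap_comp_axiom : forall X Y Z (g : hom Y Z) (f : hom X Y),
    Fmap X Z (comp g f) = comp (Fmap Y Z g) (Fmap X Y f) }.

Record functor (A B : category) := Functor {
  fob :> A -> B;
  fmap : forall X Y, hom X Y -> hom (fob X) (fob Y);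
  functorP : functor_axioms fmap }.

(* [R] is right adjoint to [L]: natural bijections
   $\mathrm{Hom}(L X, Y) \cong \mathrm{Hom}(X, R Y)$. *)
Definition right_adjoint (A B : category) (L : functor A B) (R : functor B A) :=
  exists Phi : forall X Y, hom (L X) Y -> hom X (R Y),
  [/\ forall X Y, bijective (Phi X Y),
      forall X X' Y (g : hom X' X) (f : hom (L X) Y),
        Phi X' Y (comp f (fmap L g)) = comp (Phi X Y f) g
    & forall X Y Y' (h : hom Y Y') (f : hom (L X) Y),
        Phi X Y' (comp h f) = comp (fmap R h) (Phi X Y f)].

Section Morphisms.
Context (k : fieldType).

Record coalg_hom (C D : coalg k) := CoalgHom {
  coalg_fun :> {linear C -> D};
  coalg_hom_comul : forall c, comul D (coalg_fun c) = tmap coalg_fun coalg_fun (comul C c);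
  coalg_hom_counit : forall c, counit D (coalg_fun c) = counit C c }.

(* [cores f W]: the $C$-bicomodule $W$ as a $D$-bicomodule along $f : C \to D$. *)
Section Corestriction.
Context (C D : coalg k) (f : coalg_hom C D) (W : bicomod C).

Definition cores_lcoact : {linear W -> D ⊗ W} := tmap f idl \o lcoact W.
Definition cores_rcoact : {linear W -> W ⊗ D} := tmap idl f \o rcoact W.

Fact cores_lcoactA w : tassoc (tmap (comul D) idl (cores_lcoact w)) =
  tmap idl cores_lcoact (cores_lcoact w).
Proof.
rewrite /cores_lcoact /= !tmap_comp.
have -> : tmap (comul D \o f) (idl \o idl) (lcoact W w) =
    tmap (tmap f f) idl (tmap (comul C) idl (lcoact W w)).
  by rewrite tmap_comp; apply: eq_tmap => // c; rewrite /= coalg_hom_comul.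
by rewrite tassoc_nat lcoactA tmap_comp; apply: eq_tmap.
Qed.
Fact cores_rcoactA w : tassoc (tmap cores_rcoact idl (cores_rcoact w)) =
  tmap idl (comul D) (cores_rcoact w).
Proof.
rewrite /cores_rcoact /= !tmap_comp.
have -> : tmap (idl \o idl) (comul D \o f) (rcoact W w) =
    tmap idl (tmap f f) (tmap idl (comul C) (rcoact W w)).
  by rewrite tmap_comp; apply: eq_tmap => // c; rewrite /= coalg_hom_comul.
rewrite -rcoactA -tassoc_nat tmap_comp; congr (tassoc _).
by apply: eq_tmap.
Qed.
Fact cores_lrcoact w : tassoc (tmap cores_lcoact idl (cores_rcoact w)) =
  tmap idl cores_rcoact (cores_lcoact w).
Proof.
rewrite /cores_lcoact /cores_rcoact /= !tmap_comp.
have -> : tmap (idl \o f) ((tmap idl f \o rcoact W) \o idl) (lcoact W w) =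
    tmap f (tmap idl f) (tmap idl (rcoact W) (lcoact W w)).
  by rewrite tmap_comp; apply: eq_tmap.
rewrite -lrcoact -tassoc_nat tmap_comp; congr (tassoc _).
by apply: eq_tmap.
Qed.
Let contr_cores (x : C ⊗ W) : contrl (counit D) (tmap f idl x) = contrl (counit C) x.
Proof.
move: x; apply: (tens_ext (f := contrl (counit D) \o tmap f idl)) => c v.
by rewrite /= tmapE !contrlE coalg_hom_counit.
Qed.
Let contr_coresr (x : W ⊗ C) : contrr (counit D) (tmap idl f x) = contrr (counit C) x.
Proof.
move: x; apply: (tens_ext (f := contrr (counit D) \o tmap idl f)) => v c.
by rewrite /= tmapE !contrrE coalg_hom_counit.
Qed.
Fact cores_lcoact1 w : contrl (counit D) (cores_lcoact w) = w.
Proof. by rewrite [LHS]contr_cores lcoact1. Qed.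
Fact cores_rcoact1 w : contrr (counit D) (cores_rcoact w) = w.
Proof. by rewrite [LHS]contr_coresr rcoact1. Qed.

Definition cores : bicomod D :=
  Bicomod cores_lcoactA cores_lcoact1 cores_rcoactA cores_rcoact1 cores_lrcoact.
End Corestriction.

Definition bicolinear (C : coalg k) (V W : bicomod C) (g : {linear V -> W}) :=
  (forall v, lcoact W (g v) = tmap idl g (lcoact V v)) /\
  (forall v, rcoact W (g v) = tmap g idl (rcoact V v)).

Definition codifferentiable (X Y : focc k) (f : coalg_hom (focc_base X) (focc_base Y)) :=
  exists g : {linear cores f (focc_mod X) -> focc_mod Y},
    bicolinear g /\ forall w, focc_d Y (g w) = f (focc_d X w).

Record focc_hom (X Y : focc k) := FoccHom {
  focc_fun :> coalg_hom (focc_base X) (focc_base Y);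
  focc_homP : codifferentiable focc_fun }.

Record dg_hom (D E : dgcoalg k) := DGHom {
  dg_fun :> forall n, {linear D n -> E n};
  dg_hom_comul : forall n i j (x : D n),
    dg_comul E n i j (dg_fun n x) = tmap (dg_fun i) (dg_fun j) (dg_comul D n i j x);
  dg_hom_counit : forall x, dg_counit E (dg_fun 0 x) = dg_counit D x;
  dg_hom_d : forall n (x : D n.+1), dg_d E n (dg_fun n.+1 x) = dg_fun n (dg_d D n x) }.

Lemma coalg_hom_eq C D (f g : coalg_hom C D) : f =1 g -> f = g.
Proof.
case: f g => [f f1 f2] [g g1 g2] /= /linear_eq fg; subst g.
by rewrite (Prop_irrelevance f1 g1) (Prop_irrelevance f2 g2).
Qed.
Lemma focc_hom_eq X Y (f g : focc_hom X Y) : f =1 g -> f = g.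
Proof.
case: f g => [f f1] [g g1] /= /coalg_hom_eq fg; subst g.
by rewrite (Prop_irrelevance f1 g1).
Qed.
Lemma dg_hom_eq D E (f g : dg_hom D E) : (forall n, f n =1 g n) -> f = g.
Proof.
case: f g => [f f1 f2 f3] [g g1 g2 g3] /= fg.
have {}fg : f = g by apply: functional_extensionality_dep => n; exact: linear_eq (fg n).
subst g; rewrite (Prop_irrelevance f1 g1) (Prop_irrelevance f2 g2).
by rewrite (Prop_irrelevance f3 g3).
Qed.

Section FoccCategory.

Fact coalg_id_comul (C : coalg k) c : comul C (idl c) = tmap idl idl (comul C c).
Proof. by rewrite tmap_id. Qed.
Definition coalg_id C : coalg_hom C C :=
  @CoalgHom C C idl (@coalg_id_comul C) (fun=> erefl).

Section Comp.
Context {C D E : coalg k} (g : coalg_hom D E) (f : coalg_hom C D).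
Fact coalg_comp_comul c : comul E ((g \o f) c) = tmap (g \o f) (g \o f) (comul C c).
Proof. by rewrite /= !coalg_hom_comul tmap_comp. Qed.
Fact coalg_comp_counit c : counit E ((g \o f) c) = counit C c.
Proof. by rewrite /= !coalg_hom_counit. Qed.
Definition coalg_comp : coalg_hom C E := CoalgHom coalg_comp_comul coalg_comp_counit.
End Comp.

Fact focc_id_codiff X : codifferentiable (coalg_id (focc_base X) : coalg_hom (focc_base X) (focc_base X)).
Proof.
exists idl; split=> //; split=> w /=; rewrite /cores_lcoact /cores_rcoact /=.
  by rewrite !tmap_id.
by rewrite !tmap_id.
Qed.
Definition focc_id X : focc_hom X X := FoccHom (focc_id_codiff X).

Fact focc_comp_codiff X Y Z (g : focc_hom Y Z) (f : focc_hom X Y) :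
  codifferentiable (coalg_comp g f).
Proof.
case: (focc_homP f) => f' [[fl fr] fd]; case: (focc_homP g) => g' [[gl gr] gd].
exists (g' \o f'); split; last by move=> w; rewrite /= gd fd.
split=> w /=.
  rewrite gl /= /cores_lcoact /= fl /= /cores_lcoact /= !tmap_comp.
  exact: eq_tmap.
rewrite gr /= /cores_rcoact /= fr /= /cores_rcoact /= !tmap_comp.
exact: eq_tmap.
Qed.
Definition focc_comp X Y Z (g : focc_hom Y Z) (f : focc_hom X Y) : focc_hom X Z :=
  FoccHom (focc_comp_codiff g f).

Definition FOCC : category.
Proof.
by refine (@Category (focc k) focc_hom focc_id focc_comp _ _ _) => *;
  apply: focc_hom_eq.
Defined.
End FoccCategory.

Section DGCategory.

Fact dg_id_comul (D : dgcoalg k) n i j (x : D n) :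
  dg_comul D n i j (idl x) = tmap idl idl (dg_comul D n i j x).
Proof. by rewrite tmap_id. Qed.
Definition dg_id (D : dgcoalg k) : dg_hom D D :=
  @DGHom D D (fun n => idl) (@dg_id_comul D) (fun=> erefl) (fun _ _ => erefl).

Section Comp.
Context {D E F : dgcoalg k} (g : dg_hom E F) (f : dg_hom D E).
Fact dg_comp_comul n i j (x : D n) : dg_comul F n i j ((g n \o f n) x) =
  tmap (g i \o f i) (g j \o f j) (dg_comul D n i j x).
Proof. by rewrite /= !dg_hom_comul tmap_comp. Qed.
Fact dg_comp_counit (x : D 0) : dg_counit F ((g 0 \o f 0) x) = dg_counit D x.
Proof. by rewrite /= !dg_hom_counit. Qed.
Fact dg_comp_d n (x : D n.+1) :
  dg_d F n ((g n.+1 \o f n.+1) x) = (g n \o f n) (dg_d D n x).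
Proof. by rewrite /= !dg_hom_d. Qed.
Definition dg_comp : dg_hom D F :=
  @DGHom D F (fun n => g n \o f n) dg_comp_comul dg_comp_counit dg_comp_d.
End Comp.

Definition dgCoalg : category.
Proof.
by refine (@Category (dgcoalg k) dg_hom dg_id (@dg_comp) _ _ _) => *;
  apply: dg_hom_eq.
Defined.
End DGCategory.

Section W1Functor.

Section Map.
Context (D E : dgcoalg k) (f : dg_hom D E).

Fact dg_hom0_comul c : comul (dg_deg0 E) (f 0 c) = tmap (f 0) (f 0) (comul (dg_deg0 D) c).
Proof. exact: dg_hom_comul. Qed.
Definition dg_hom0 : coalg_hom (dg_deg0 D) (dg_deg0 E) :=
  @CoalgHom (dg_deg0 D) (dg_deg0 E) (f 0) dg_hom0_comul (@dg_hom_counit _ _ f).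

Let KD := lin_ker (ufocc_map (dg_d D 0 : {linear dg_deg1 D -> dg_deg0 D})).
Let KE := lin_ker (ufocc_map (dg_d E 0 : {linear dg_deg1 E -> dg_deg0 E})).

Fact dg_hom1_subproof u : u \in KD -> (quot_pi KE \o f 1) u = 0.
Proof.
move=> /eqP/ufocc_pi_eq0[c hc]; apply/eqP; rewrite /= quot_pi_eq0; apply/eqP.
rewrite /ufocc_map /= dg_hom_comul tmap_comp.
rewrite (eq_tmap (f' := f 0 \o idl) (g' := f 0 \o dg_d D 0)) //; last first.
  by move=> x; rewrite /= dg_hom_d.
by rewrite -tmap_comp -hc -dg_hom0_comul ufocc_pi_comul.
Qed.

Fact dg_hom0_codiff : codifferentiable (X := dg_focc D) (Y := dg_focc E) dg_hom0.
Proof.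
exists (quot_lift dg_hom1_subproof : {linear cores dg_hom0 (focc_mod (dg_focc D)) -> focc_mod (dg_focc E)}).
split; last first.
  move=> x; have [w <-] := quot_piP x.
  by rewrite quot_liftE /= !quot_liftE dg_hom_d.
split=> x; have [w <-] := quot_piP x; rewrite quot_liftE /= !quot_liftE /=.
  rewrite dg_hom_comul !tmap_comp; apply: eq_tmap => // y.
  by rewrite /= quot_liftE.
rewrite dg_hom_comul !tmap_comp; apply: eq_tmap => // y.
by rewrite /= quot_liftE.
Qed.
Definition dg_focc_map : focc_hom (dg_focc D) (dg_focc E) := FoccHom dg_hom0_codiff.
End Map.

Fact W1_axioms : @functor_axioms dgCoalg FOCC (@dg_focc k) dg_focc_map.
Proof. by split=> *; apply: focc_hom_eq. Qed.
Definition W1 : functor dgCoalg FOCC := Functor W1_axioms.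
End W1Functor.
End Morphisms.

Section Submodules.
Context {k : fieldType}.

Definition full_pred (V : lmodType k) : {pred V} := xpredT.
Fact full_submod V : submod_closed (@full_pred V). Proof. by []. Qed.
HB.instance Definition _ V :=
  GRing.isSubmodClosed.Build k V (@full_pred V) (@full_submod V).
Definition fullS (V : lmodType k) : submodClosed V := @full_pred V.

Section Cap.
Context {V : lmodType k} (A B : submodClosed V).
Definition cap_pred : {pred V} := fun v => (v \in A) && (v \in B).
Fact cap_submod : submod_closed cap_pred.
Proof.
split=> [|a u v /andP[uA uB] /andP[vA vB]]; apply/andP; split;
  by rewrite ?rpred0 // rpredD ?rpredZ.
Qed.
HB.instance Definition _ := GRing.isSubmodClosed.Build k V cap_pred cap_submod.
Definition capS : submodClosed V := cap_pred.
End Cap.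

Section Preim.
Context {V W : lmodType k} (f : {linear V -> W}) (B : submodClosed W).
Definition preim_pred : {pred V} := fun v => f v \in B.
Fact preim_submod : submod_closed preim_pred.
Proof.
split=> [|a u v hu hv]; rewrite unfold_in /preim_pred ?linear0 ?rpred0 //.
by rewrite linearP rpredD ?rpredZ.
Qed.
HB.instance Definition _ := GRing.isSubmodClosed.Build k V preim_pred preim_submod.
Definition preimS : submodClosed V := preim_pred.
End Preim.

(* The image of $A \otimes B$ in $V \otimes W$. *)
Definition tensS {V W : lmodType k} (A : submodClosed V) (B : submodClosed W) :
  submodClosed (V ⊗ W) :=
  span [set x | exists a b, [/\ a \in A, b \in B & x = pure a b]].

End Submodules.

Section Cotensor.
Context {k : fieldType} (C : coalg k).

(* The cotensor product of $V$ and $W$, as a subspace of $V \otimes W$;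
   only the two inner coactions matter. *)
Definition cotens (V W : lmodType k) (rho : {linear V -> V ⊗ C})
    (lam : {linear W -> C ⊗ W}) : submodClosed (V ⊗ W) :=
  lin_ker ((tassoc \o tmap rho idl) \- tmap idl lam).

Definition sub_bicomodule (V : lmodType k) (lam : {linear V -> C ⊗ V})
    (rho : {linear V -> V ⊗ C}) (S : submodClosed V) : Prop :=
  {in S, forall v, lam v \in tensS (fullS C) S} /\
  {in S, forall v, rho v \in tensS S (fullS C)}.

End Cotensor.

Section Cast.
Context {k : fieldType} (T : nat -> lmodType k).
(* The identity of [T m] if [m = n], and zero otherwise. *)
Definition degcast m n : {linear T m -> T n} :=
  match m =P n with
  | ReflectT e => match e in _ = n' return {linear T m -> T n'} with erefl => idl end
  | ReflectF _ => \0
  end.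
End Cast.

Section MaximalProlongation.
Context {k : fieldType} (X : focc k).
Local Notation C := (focc_base X).
Local Notation W := (focc_mod X).
Local Notation delta := (focc_d X).
Local Notation phi := (ufocc_map (focc_d X)).

(* [tpow n] is $\mathscr{W}_1^{\otimes (n+1)}$. *)
Fixpoint tpow n : lmodType k := if n is m.+1 then W ⊗ tpow m else W.

Definition tpow_lcoact n : {linear tpow n -> C ⊗ tpow n} :=
  match n with
  | 0 => lcoact W
  | m.+1 => tassoc \o tmap (lcoact W) idl
  end.

Fixpoint tpow_rcoact n : {linear tpow n -> tpow n ⊗ C} :=
  match n with
  | 0 => rcoact W
  | m.+1 => tassocV \o tmap idl (tpow_rcoact m)
  end.

(* $\mathscr{W}_1^{\otimes (i+j+2)} \cong
   \mathscr{W}_1^{\otimes (i+1)} \otimes \mathscr{W}_1^{\otimes (j+1)}$ *)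
Fixpoint deconc i j : {linear tpow (i + j).+1 -> tpow i ⊗ tpow j} :=
  match i with
  | 0 => idl
  | i'.+1 => tassocV \o tmap idl (deconc i' j)
  end.

Definition cotensS i j (A : submodClosed (tpow i)) (B : submodClosed (tpow j)) :
  submodClosed (tpow (i + j).+1) :=
  preimS (deconc i j) (capS (tensS A B) (cotens (tpow_rcoact i) (tpow_lcoact j))).

(* [cotpow n] is $\mathscr{W}_1^{\square_C (n+1)}$. *)
Fixpoint cotpow n : submodClosed (tpow n) :=
  match n with
  | 0 => fullS W
  | m.+1 => cotensS (i := 0) (fullS W) (cotpow m)
  end.

Definition max_check2 : {linear W ⊗ W -> ufocc C} := ufocc_pi C \o tmap delta delta.

Definition max_sub2 : submodClosed (tpow 1) :=
  span [set u | exists S : submodClosed (tpow 1),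
    [/\ {subset S <= cotpow 1}, sub_bicomodule (tpow_lcoact 1) (tpow_rcoact 1) S,
        {in S, forall s, max_check2 s \in lin_im phi} & u \in S]].

(* $\mathscr{W}_2^{\mathrm{max}} \square_C \mathscr{W}_1^{\square_C j}$ and
   $\mathscr{W}_1^{\square_C i} \square_C \mathscr{W}_2^{\mathrm{max}} \square_C
   \mathscr{W}_1^{\square_C j}$; a factor of exponent zero is $C$, and is dropped. *)
Definition max_sub2r j : submodClosed (tpow j.+1) :=
  match j with
  | 0 => max_sub2
  | j'.+1 => cotensS (i := 1) max_sub2 (cotpow j')
  end.
Definition max_slot i j : submodClosed (tpow (i + j.+1)) :=
  match i with
  | 0 => max_sub2r j
  | i'.+1 => cotensS (cotpow i') (max_sub2r j)
  end.

Section Sub.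
Variable n : nat.
Definition max_sub_pred : {pred tpow n} := fun u =>
  `[< forall i j, (i + j.+1)%N = n -> degcast tpow n (i + j.+1) u \in max_slot i j >].
Fact max_sub_submod : submod_closed max_sub_pred.
Proof.
split=> [|a u v /asboolP hu /asboolP hv]; apply/asboolP => i j e.
  by rewrite linear0 rpred0.
by rewrite linearP rpredD ?rpredZ ?hu ?hv.
Qed.
HB.instance Definition _ :=
  GRing.isSubmodClosed.Build k (tpow n) max_sub_pred max_sub_submod.
(* $\mathscr{W}_{n+1}^{\mathrm{max}}$ inside $\mathscr{W}_1^{\otimes (n+1)}$. *)
Definition max_sub : submodClosed (tpow n) := max_sub_pred.
End Sub.

(* $\delta_2$, extended to $\mathscr{W}_1 \otimes \mathscr{W}_1$ by means of a
   linear left inverse of $\varphi$. *)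
Definition max_d2 : {linear W ⊗ W -> W} := lretr phi \o max_check2.

Lemma max_d2P u : u \in max_sub2 -> phi (max_d2 u) = max_check2 u.
Proof.
move=> hu.
have : u \in preimS max_check2 (lin_im phi).
  by apply: (span_min _ hu) => s [S [_ _ h Ss]]; exact: h.
move=> /lin_imP[w hw].
rewrite -[max_d2 u]/(lretr phi (max_check2 u)) -hw lretrK //.
by apply: ufocc_map_inj; [exact: focc_coder|exact: focc_inj].
Qed.

(* $\mathrm{id}^{\otimes i} \otimes \delta_2 \otimes \mathrm{id}$, which is
   meaningful for $i \le n$ only. *)
Fixpoint max_d_at i n : {linear tpow n.+1 -> tpow n} :=
  match i, n with
  | 0, 0 => max_d2
  | 0, m.+1 => tmap max_d2 idl \o tassocV
  | i'.+1, m.+1 => tmap idl (max_d_at i' m)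
  | _.+1, 0 => \0
  end.

Definition max_d_sum n (u : tpow n.+1) : tpow n :=
  \sum_(i < n.+1) (-1) ^+ i *: max_d_at i n u.
Fact max_d_sum_linear n : linear (@max_d_sum n).
Proof.
move=> a u v; rewrite /max_d_sum scaler_sumr -big_split; apply: eq_bigr => i _.
by rewrite linearP scalerDr !scalerA mulrC.
Qed.

(* Ambient spaces: $C$ in degree $0$, $\mathscr{W}_1^{\otimes n}$ in degree
   $n \ge 1$, and the formulas for the coproduct and the differential on them. *)
Definition amb n : lmodType k := if n is m.+1 then tpow m else C.

Definition amb_comul n i j : {linear amb n -> amb i ⊗ amb j} :=
  match n, i, j with
  | 0, 0, 0 => comul C
  | m.+1, 0, j'.+1 => tpow_lcoact j' \o degcast tpow m j'
  | m.+1, i'.+1, 0 => tpow_rcoact i' \o degcast tpow m i'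
  | m.+1, i'.+1, j'.+1 => deconc i' j' \o degcast tpow m (i' + j').+1
  | _, _, _ => \0
  end.

Definition amb_d n : {linear amb n.+1 -> amb n} :=
  match n with
  | 0 => delta
  | m.+1 => mklin (@max_d_sum_linear m)
  end.

Definition max_sp n : lmodType k := if n is m.+1 then subsp (max_sub m) else C.

Definition max_incl n : {linear max_sp n -> amb n} :=
  match n with
  | 0 => idl
  | m.+1 => subsp_incl (max_sub m)
  end.

(* The structure maps are the restrictions of those of the ambient spaces, see
   [max_restricts]; [lretr] corestricts them. *)
Definition max_comul n i j : {linear max_sp n -> max_sp i ⊗ max_sp j} :=
  lretr (tmap (max_incl i) (max_incl j)) \o amb_comul n i j \o max_incl n.
Definition max_d n : {linear max_sp n.+1 -> max_sp n} :=
  lretr (max_incl n) \o amb_d n \o max_incl n.+1.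

Definition max_prolongation : dgdata k := @DGData k max_sp max_comul (counit C) max_d.

Definition max_restricts : Prop :=
  (forall n i j (x : max_sp n),
     tmap (max_incl i) (max_incl j) (max_comul n i j x) = amb_comul n i j (max_incl n x)) /\
  (forall n (x : max_sp n.+1), max_incl n (max_d n x) = amb_d n (max_incl n.+1 x)).

End MaximalProlongation.

(* Main.v *)
Require Import Defs.
From HB Require Import structures.
From mathcomp Require Import all_boot all_algebra.
From mathcomp Require Import boolp.

Set Implicit Arguments.
Unset Strict Implicit.
Unset Printing Implicit Defensive.

Import GRing.Theory.
Local Open Scope ring_scope.

(** The extension of a codifferentiable map $f = f_0$ is forced.
    Codifferentiability provides $f_1 \colon D_1 \to \mathscr{W}_1$, and since
    the coproduct of $\mathscr{W}_\bullet^{\mathrm{max}}$ is deconcatenation,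
    the component of degree $n$ must be $f_1^{\otimes n}$ after the iterated
    coproduct $D_n \to D_1^{\otimes n}$ ([ext_pos]). Uniqueness is then clear
    in degrees at least two, and in degree one it follows from the injectivity
    in the definition of an FOCC ([max_hom_eq]).

    Existence rests on one computation in degree two ([ext_check2]): by the
    co-Leibniz rule and $\delta^2 = 0$ in $D_\bullet$, $[\delta f_1(x_{(1)})
    \otimes \delta f_1(x_{(2)})] = \varphi(f_1(\delta x))$ for $x \in D_2$,
    where $x_{(1)} \otimes x_{(2)}$ is the component of degree $(1,1)$ of the
    coproduct. So the image of $D_2$ is a bicomodule of the kind of which
    $\mathscr{W}_2^{\mathrm{max}}$ is the largest one, and $\delta_2 f_2 = f_1
    \delta$. Everything in higher degrees follows from this by
    coassociativity.

    Before this, $\mathscr{W}_\bullet^{\mathrm{max}}$ has to be shown to be a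
    dg coalgebra. The structure maps are defined by formulas on the full
    tensor powers of $\mathscr{W}_1$. There, coassociativity holds up to the
    cotensor conditions ([amb_comulA]), and the co-Leibniz rule holds in
    positive degrees ([cut_tpow_d]). The co-Leibniz rule that involves the
    outer coactions is reduced to $\delta_2$ ([lam_d2], [rho_d2]), where it is
    verified after composing with the injection $\varphi$ into the universal
    FOCC. That the subspaces are preserved is seen from a recursive
    description of $\mathscr{W}_n^{\mathrm{max}}$ ([max_rec], [max_subE]),
    which uses the exactness of the tensor product over a field to commute
    tensor products with intersections. The differential preserves them
    because $\mathscr{W}_2^{\mathrm{max}} +
    \delta_3(\mathscr{W}_3^{\mathrm{max}})$ satisfies the conditions of which
    $\mathscr{W}_2^{\mathrm{max}}$ is the largest solution ([tpow_d1_mem]);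
    this also yields $\delta_2 \delta_3 = 0$, from which $\delta^2 = 0$
    follows.

    Finally, the extension of the identity-on-$C$ map
    $\underline{\mathscr{W}_1}(\mathscr{W}_\bullet^{\mathrm{max}}) \to
    \mathscr{W}_1$ is the counit of the adjunction ([max_counit]), and
    functoriality and naturality follow from uniqueness. *)

(** * Functoriality of the tensor product *)

Section TensorLinearity.
Context {k : fieldType}.
Implicit Types U V W : lmodType k.

Lemma tmap_linl {V V' W W'} (a b : k) (f f1 f2 : {linear V -> V'})
    (g : {linear W -> W'}) x :
  (forall v, f v = a *: f1 v + b *: f2 v) ->
  tmap f g x = a *: tmap f1 g x + b *: tmap f2 g x.
Proof.
move=> fE; move: x.
apply: (tens_ext (g := (a \*: tmap f1 g) \+ (b \*: tmap f2 g))) => v w.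
rewrite /= !tmapE fE pure_linearl; congr (_ + _).
by have := pure_linearl (g w) b (f2 v) 0; rewrite addr0 pure0l addr0.
Qed.

Lemma tmap_linr {V V' W W'} (a b : k) (f : {linear V -> V'})
    (g g1 g2 : {linear W -> W'}) x :
  (forall w, g w = a *: g1 w + b *: g2 w) ->
  tmap f g x = a *: tmap f g1 x + b *: tmap f g2 x.
Proof.
move=> gE; move: x.
apply: (tens_ext (g := (a \*: tmap f g1) \+ (b \*: tmap f g2))) => v w.
rewrite /= !tmapE gE pure_linearr; congr (_ + _).
by have := pure_linearr (f v) b (g2 w) 0; rewrite addr0 pure0 addr0.
Qed.

Lemma tmapBr {V V' W W'} (f : {linear V -> V'}) (g g1 g2 : {linear W -> W'}) x :
  (forall w, g w = g1 w - g2 w) -> tmap f g x = tmap f g1 x - tmap f g2 x.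
Proof.
move=> gE; rewrite (@tmap_linr _ _ _ _ 1 (-1) f g g1 g2) => [|w].
  by rewrite scale1r scaleN1r.
by rewrite gE scale1r scaleN1r.
Qed.

Lemma tmapBl {V V' W W'} (f f1 f2 : {linear V -> V'}) (g : {linear W -> W'}) x :
  (forall v, f v = f1 v - f2 v) -> tmap f g x = tmap f1 g x - tmap f2 g x.
Proof.
move=> fE; rewrite (@tmap_linl _ _ _ _ 1 (-1) f f1 f2) => [|v].
  by rewrite scale1r scaleN1r.
by rewrite fE scale1r scaleN1r.
Qed.

Lemma tmapDl {V V' W W'} (f f1 f2 : {linear V -> V'}) (g : {linear W -> W'}) x :
  (forall v, f v = f1 v + f2 v) -> tmap f g x = tmap f1 g x + tmap f2 g x.
Proof.
move=> fE; rewrite (@tmap_linl _ _ _ _ 1 1 f f1 f2) => [|v].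
  by rewrite !scale1r.
by rewrite fE !scale1r.
Qed.

Lemma tmapZr {V V' W W'} a (f : {linear V -> V'}) (g : {linear W -> W'}) x :
  tmap f (a \*: g) x = a *: tmap f g x.
Proof.
rewrite (@tmap_linr _ _ _ _ a 0 f (a \*: g) g g) ?scale0r ?addr0 // => w.
by rewrite scale0r addr0.
Qed.

Lemma tmapZl {V V' W W'} a (f : {linear V -> V'}) (g : {linear W -> W'}) x :
  tmap (a \*: f) g x = a *: tmap f g x.
Proof.
rewrite (@tmap_linl _ _ _ _ a 0 (a \*: f) f f) ?scale0r ?addr0 // => w.
by rewrite scale0r addr0.
Qed.

Lemma tmap_compl {V V' V'' W W'} (f' : {linear V' -> V''})
    (f : {linear V -> V'}) (g : {linear W -> W'}) x :
  tmap f' idl (tmap f g x) = tmap (f' \o f) g x.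
Proof. by rewrite tmap_comp; apply: eq_tmap. Qed.

Lemma tmap_compr {V V' W W' W''} (f : {linear V -> V'})
    (g' : {linear W' -> W''}) (g : {linear W -> W'}) x :
  tmap idl g' (tmap f g x) = tmap f (g' \o g) x.
Proof. by rewrite tmap_comp; apply: eq_tmap. Qed.

Lemma tmap_splitl {V V' V'' W W'} (f' : {linear V' -> V''})
    (f : {linear V -> V'}) (g : {linear W -> W'}) x :
  tmap f' g (tmap f idl x) = tmap (f' \o f) g x.
Proof. by rewrite tmap_comp; apply: eq_tmap. Qed.

Lemma tmap_splitr {V V' W W' W''} (f : {linear V -> V'})
    (g' : {linear W' -> W''}) (g : {linear W -> W'}) x :
  tmap f g' (tmap idl g x) = tmap f (g' \o g) x.
Proof. by rewrite tmap_comp; apply: eq_tmap. Qed.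

Lemma tmap_lr {V V' W W'} (f : {linear V -> V'}) (g : {linear W -> W'}) x :
  tmap f idl (tmap idl g x) = tmap f g x.
Proof. by rewrite tmap_comp; apply: eq_tmap. Qed.

Lemma tmap_rl {V V' W W'} (f : {linear V -> V'}) (g : {linear W -> W'}) x :
  tmap idl g (tmap f idl x) = tmap f g x.
Proof. by rewrite tmap_comp; apply: eq_tmap. Qed.

End TensorLinearity.

(** * Subspaces of tensor products *)

Section TensorSubspaces.
Context {k : fieldType}.
Implicit Types U V W : lmodType k.

Lemma tensS_pure V W (A : submodClosed V) (B : submodClosed W) v w :
  v \in A -> w \in B -> pure v w \in tensS A B.
Proof. by move=> vA wB; apply: span_sub; exists v, w. Qed.

Lemma mem_tensS_full V W (x : V ⊗ W) : x \in tensS (fullS V) (fullS W).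
Proof.
move: x; apply: (@tensor_ind _ _ _ (tensor_ex V W)) => [|a x y hx hy|v w].
  exact: rpred0.
  by rewrite rpredD ?rpredZ.
exact: tensS_pure.
Qed.

Lemma tensS_tmap V V' W W' (f : {linear V -> V'}) (g : {linear W -> W'})
    (A : submodClosed V) (A' : submodClosed V') (B : submodClosed W)
    (B' : submodClosed W') x :
  {in A, forall v, f v \in A'} -> {in B, forall w, g w \in B'} ->
  x \in tensS A B -> tmap f g x \in tensS A' B'.
Proof.
move=> fA gB; apply: (span_min (U := preimS (tmap f g) (tensS A' B'))).
move=> _ [a [b [aA bB ->]]]; rewrite unfold_in /= /preim_pred tmapE.
by apply: tensS_pure; [exact: fA|exact: gB].
Qed.

Lemma tensS_sub V W (A A' : submodClosed V) (B B' : submodClosed W) :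
  {subset A <= A'} -> {subset B <= B'} -> {subset tensS A B <= tensS A' B'}.
Proof.
move=> AA BB x hx; rewrite -[x]tmap_id.
by apply: tensS_tmap hx => v; [exact: AA|exact: BB].
Qed.

(** Identities of linear maps that hold only on a subspace, such as the
    description of $\delta_2$ on $\mathscr{W}_2^{\mathrm{max}}$, are transported
    into tensor products by means of this lemma. *)
Lemma eq_tmap_in V V' W W' (f f' : {linear V -> V'}) (g g' : {linear W -> W'})
    (A : submodClosed V) (B : submodClosed W) x :
  {in A, f =1 f'} -> {in B, g =1 g'} -> x \in tensS A B ->
  tmap f g x = tmap f' g' x.
Proof.
move=> ff gg hx; apply/eqP; rewrite -subr_eq0.
apply: (span_min (U := lin_ker (tmap f g \- tmap f' g')) _ hx).
move=> _ [a [b [aA bB ->]]]; rewrite unfold_in /= /lin_ker_pred /= !tmapE.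
by rewrite ff // gg // subrr.
Qed.

Lemma tmap_eq0_in V V' W W' (f : {linear V -> V'}) (g : {linear W -> W'})
    (A : submodClosed V) (B : submodClosed W) x :
  {in A, forall v, f v = 0} -> x \in tensS A B -> tmap f g x = 0.
Proof.
move=> f0 hx; rewrite (eq_tmap_in (f' := \0) (g' := g) _ _ hx) //.
exact: tmap0l.
Qed.

Lemma tensS_assoc U V W (A : submodClosed U) (B : submodClosed V)
    (B' : submodClosed W) x :
  x \in tensS (tensS A B) B' -> tassoc x \in tensS A (tensS B B').
Proof.
apply: (span_min (U := preimS tassoc (tensS A (tensS B B')))).
move=> _ [y [w [yAB wB ->]]]; rewrite unfold_in /= /preim_pred.
apply: (span_min (U := preimS (tassoc \o mklin (pure_linearl w))
  (tensS A (tensS B B'))) _ yAB) => _ [u [v [uA vB ->]]].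
by rewrite unfold_in /= /preim_pred /= tassocE !tensS_pure.
Qed.

Lemma tensS_assocV U V W (A : submodClosed U) (B : submodClosed V)
    (B' : submodClosed W) x :
  x \in tensS A (tensS B B') -> tassocV x \in tensS (tensS A B) B'.
Proof.
apply: (span_min (U := preimS tassocV (tensS (tensS A B) B'))).
move=> _ [u [y [uA yB ->]]]; rewrite unfold_in /= /preim_pred.
apply: (span_min (U := preimS (tassocV \o mklin (pure_linearr u))
  (tensS (tensS A B) B')) _ yB) => _ [v [w [vA wB ->]]].
by rewrite unfold_in /= /preim_pred /= tassocVE !tensS_pure.
Qed.

(** A linear projection onto [A]; subspaces are fixed pointwise by it, so that
    membership in a tensor product of subspaces becomes an equation. *)
Definition proj V (A : submodClosed V) : {linear V -> V} :=
  subsp_incl A \o lretr (subsp_incl A).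

Lemma proj_mem V (A : submodClosed V) v : proj A v \in A.
Proof. by apply/subsp_inclP; eexists. Qed.

Lemma proj_id V (A : submodClosed V) v : v \in A -> proj A v = v.
Proof.
move=> /subsp_inclP[u <-]; rewrite /proj /= lretrK //.
exact: subsp_incl_inj.
Qed.

(** The projections onto [A] and onto [B] act on different legs, hence commute:
    an element that each of them fixes is the image of an element under their
    tensor product. *)
Lemma tensS_cap V W (A : submodClosed V) (B : submodClosed W) x :
  x \in tensS A (fullS W) -> x \in tensS (fullS V) B -> x \in tensS A B.
Proof.
move=> xA xB; have -> : x = tmap (proj A) (proj B) x.
  rewrite -[LHS]tmap_id.
  rewrite (eq_tmap_in (f' := idl) (g' := proj B) _ _ xB) //; last first.
    by move=> v /proj_id.
  rewrite -[in LHS](tmap_id x).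
  rewrite (eq_tmap_in (f' := proj A) (g' := idl) _ _ xA) ?tmap_comp; last 2 first.
  - by move=> v /proj_id.
  - by [].
  by apply: eq_tmap.
by apply: tensS_tmap (mem_tensS_full x) => v _; exact: proj_mem.
Qed.

(** [f] is injective on the quotient by its kernel, so it can be inverted up to
    the projection onto the kernel. This gives the exactness of the tensor
    product over a field in [tmap_kerr] and [tmap_kerl]. *)
Lemma lin_quasi_inverse V W (f : {linear V -> W}) :
  exists e : {linear W -> V}, forall v, e (f v) = v - proj (lin_ker f) v.
Proof.
have f0 u : u \in lin_ker f -> f u = 0 by move/eqP.
have p0 u : u \in lin_ker f -> (idl \- proj (lin_ker f)) u = 0.
  by move=> /proj_id /= ->; rewrite subrr.
exists (quot_lift p0 \o lretr (quot_lift f0)) => v /=.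
rewrite -[f v](quot_liftE f0) lretrK ?quot_liftE //.
apply: lin_inj => x; have [u <-] := quot_piP x; rewrite quot_liftE => fu0.
by apply/eqP; rewrite quot_pi_eq0; apply/eqP.
Qed.

Lemma tmap_kerr U V W (f : {linear V -> W}) (x : U ⊗ V) :
  tmap idl f x = 0 -> x \in tensS (fullS U) (lin_ker f).
Proof.
move=> fx0; have [e eE] := lin_quasi_inverse f.
have -> : x = tmap idl (proj (lin_ker f)) x.
  rewrite -[LHS]tmap_id (tmapDr _ (g1 := proj (lin_ker f)) (g2 := e \o f)).
    rewrite [X in _ + X](_ : _ = 0) ?addr0 //.
    by rewrite -tmap_compr fx0 linear0.
  by move=> v; rewrite /= eE addrC subrK.
by apply: tensS_tmap (mem_tensS_full x) => v _ //; exact: proj_mem.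
Qed.

Lemma tmap_kerl U V W (f : {linear V -> W}) (x : V ⊗ U) :
  tmap f idl x = 0 -> x \in tensS (lin_ker f) (fullS U).
Proof.
move=> fx0; have [e eE] := lin_quasi_inverse f.
have -> : x = tmap (proj (lin_ker f)) idl x.
  rewrite -[LHS]tmap_id (tmapDl (f1 := proj (lin_ker f)) (f2 := e \o f)).
    rewrite [X in _ + X](_ : _ = 0) ?addr0 //.
    by rewrite -tmap_compl fx0 linear0.
  by move=> v; rewrite /= eE addrC subrK.
by apply: tensS_tmap (mem_tensS_full x) => v _ //; exact: proj_mem.
Qed.

(** A subspace is the kernel of the projection onto the quotient, and tensoring
    commutes with kernels. *)
Lemma tensS_preimr U V W (f : {linear V -> W}) (B : submodClosed W) (x : U ⊗ V) :
  tmap idl f x \in tensS (fullS U) B -> x \in tensS (fullS U) (preimS f B).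
Proof.
move=> hx; have: tmap idl (quot_pi B \o f) x = 0.
  rewrite -tmap_compr.
  rewrite (eq_tmap_in (f' := idl) (g' := \0) _ _ hx) //; first exact: tmap0r.
  by move=> w wB; apply/eqP; rewrite quot_pi_eq0.
move=> /tmap_kerr; apply: tensS_sub => // v /eqP /= /eqP.
by rewrite quot_pi_eq0.
Qed.

Lemma tensS_preiml U V W (f : {linear V -> W}) (B : submodClosed W) (x : V ⊗ U) :
  tmap f idl x \in tensS B (fullS U) -> x \in tensS (preimS f B) (fullS U).
Proof.
move=> hx; have: tmap (quot_pi B \o f) idl x = 0.
  rewrite -tmap_compl.
  rewrite (eq_tmap_in (f' := \0) (g' := idl) _ _ hx) //; first exact: tmap0l.
  by move=> w wB; apply/eqP; rewrite quot_pi_eq0.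
move=> /tmap_kerl; apply: tensS_sub => // v /eqP /= /eqP.
by rewrite quot_pi_eq0.
Qed.

(** The intersection is the preimage of [B] under the inclusion of [A], so that
    [tensS_preimr] applies. *)
Lemma tensS_capr U V (A B : submodClosed V) (x : U ⊗ V) :
  x \in tensS (fullS U) A -> x \in tensS (fullS U) B ->
  x \in tensS (fullS U) (capS A B).
Proof.
move=> xA xB; have xE : tmap idl (proj A) x = x.
  rewrite -[RHS]tmap_id; apply: (eq_tmap_in _ _ xA) => // v; exact: proj_id.
rewrite -xE in xB; move/tensS_preimr: xB => /(tensS_tmap (f := idl) (g := proj A)) h.
rewrite -xE; apply: h => // v hv; apply/andP; split=> //; exact: proj_mem.
Qed.

Lemma tensS_capl U V (A B : submodClosed V) (x : V ⊗ U) :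
  x \in tensS A (fullS U) -> x \in tensS B (fullS U) ->
  x \in tensS (capS A B) (fullS U).
Proof.
move=> xA xB; have xE : tmap (proj A) idl x = x.
  rewrite -[RHS]tmap_id; apply: (eq_tmap_in _ _ xA) => // v; exact: proj_id.
rewrite -xE in xB; move/tensS_preiml: xB => /(tensS_tmap (f := proj A) (g := idl)) h.
rewrite -xE; apply: h => // v hv; apply/andP; split=> //; exact: proj_mem.
Qed.

(** The conditions that define $\mathscr{W}_n^{\mathrm{max}}$ form a finite
    intersection; this lemma moves such an intersection across a tensor factor.
    The subspace [B] is the intersection of the [S i], constructed along the
    induction. *)
Lemma tensS_bigcapr U V (S : nat -> submodClosed V) n (x : U ⊗ V) :
  (forall i, (i < n)%N -> x \in tensS (fullS U) (S i)) ->
  exists2 B : submodClosed V, x \in tensS (fullS U) B &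
    {in B, forall v i, (i < n)%N -> v \in S i}.
Proof.
elim: n => [|n IH] hx.
  by exists (fullS V) => //; exact: mem_tensS_full.
have [|B xB BS] := IH; first by move=> i lt_in; apply/hx/ltnW.
exists (capS B (S n)); first by apply: tensS_capr => //; exact: hx.
move=> v /andP[vB vS] i; rewrite ltnS leq_eqVlt => /predU1P[->//|].
exact: BS.
Qed.

(** Used with inclusions, to lift an element of a tensor product of subspaces to
    the tensor product of the spaces that model them. *)
Lemma tensS_im V V' W W' (f : {linear V -> V'}) (g : {linear W -> W'})
    (A : submodClosed V') (B : submodClosed W') x :
  {in A, forall v, exists u, f u = v} -> {in B, forall w, exists u, g u = w} ->
  x \in tensS A B -> exists y, tmap f g y = x.
Proof.
move=> fA gB xAB; apply/lin_imP.
apply: (span_min _ xAB) => _ [v [w [/fA[a <-] /gB[b <-] ->]]].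
by apply/lin_imP; exists (pure a b); rewrite tmapE.
Qed.

End TensorSubspaces.

(** * Propagating coassociativity through associators *)

Section Coassociativity.
Context {k : fieldType}.

Lemma tens4_ext {U V W T Z : lmodType k} (f g : {linear U ⊗ (V ⊗ (W ⊗ T)) -> Z}) :
  (forall u v w t, f (pure u (pure v (pure w t))) = g (pure u (pure v (pure w t)))) ->
  f =1 g.
Proof.
move=> h; apply: tens_ext => u.
apply: (tens3_ext (f := f \o mklin (pure_linearr u))
                  (g := g \o mklin (pure_linearr u))) => v w t.
exact: h.
Qed.

Lemma pentagon {U V W T : lmodType k} (x : (U ⊗ V) ⊗ (W ⊗ T)) :
  tassoc (tmap tassoc idl (tassocV x)) = tmap idl tassocV (tassoc x).
Proof.
rewrite -[x]tassocK; move: (tassoc x).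
apply: (tens4_ext (f := tassoc \o tmap tassoc idl \o tassocV \o tassocV)
  (g := tmap idl tassocV \o tassoc \o tassocV)) => u v w t.
by rewrite /= !(tassocVE, tassocE, tmapE).
Qed.

Lemma pentagonV {U V W T : lmodType k} (x : U ⊗ ((V ⊗ W) ⊗ T)) :
  tassoc (tmap tassocV idl (tassocV x)) = tassocV (tmap idl tassoc x).
Proof.
have {1}-> : x = tmap idl tassocV (tmap idl tassoc x).
  by rewrite tmap_compr -[LHS]tmap_id; apply: eq_tmap => // y; rewrite /= tassocK.
move: (tmap _ _ x).
apply: (tens4_ext (f := tassoc \o tmap tassocV idl \o tassocV \o tmap idl tassocV)
  (g := tassocV)) => u v w t.
by rewrite /= !(tmapE, tassocVE, tassocE).
Qed.

Lemma pentagonVV {U V W T : lmodType k} (x : U ⊗ (V ⊗ (W ⊗ T))) :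
  tmap tassocV idl (tassocV (tmap idl tassocV x)) = tassocV (tassocV x).
Proof.
rewrite -[LHS]tassocK pentagonV tmap_compr; congr (tassocV (tassocV _)).
by rewrite -[RHS]tmap_id; apply: eq_tmap => // y; rewrite /= tassocVK.
Qed.

Lemma pentagonA {U V W T : lmodType k} (x : ((U ⊗ V) ⊗ W) ⊗ T) :
  tassoc (tassoc x) = tmap idl tassoc (tassoc (tmap tassoc idl x)).
Proof.
rewrite -[x]tassocK; move: (tassoc x) => y; rewrite -[y]tassocK.
move: (tassoc y) => {x y}.
apply: (tens4_ext (f := tassoc \o tassoc \o tassocV \o tassocV)
  (g := tmap idl tassoc \o tassoc \o tmap tassoc idl \o tassocV \o tassocV)) => u v w t.
by rewrite /= !(tassocVE, tassocE, tmapE).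
Qed.

Lemma tassoc_tmapl {U V W T : lmodType k} (f : {linear W -> T}) (x : (U ⊗ V) ⊗ W) :
  tassoc (tmap idl f x) = tmap idl (tmap idl f) (tassoc x).
Proof.
by rewrite -tassoc_nat; congr (tassoc _); apply: eq_tmap => // y; rewrite tmap_id.
Qed.

Lemma tassocV_tmapr {U V W T : lmodType k} (f : {linear U -> T}) (x : U ⊗ (V ⊗ W)) :
  tassocV (tmap f idl x) = tmap (tmap f idl) idl (tassocV x).
Proof.
by rewrite -tassocV_nat; congr (tassocV _); apply: eq_tmap => // y; rewrite tmap_id.
Qed.

Lemma tmap_tassoc {U V W T : lmodType k} (f : {linear U -> T}) (x : (U ⊗ V) ⊗ W) :
  tmap f idl (tassoc x) = tassoc (tmap (tmap f idl) idl x).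
Proof. by rewrite tassoc_nat; apply: eq_tmap => // y; rewrite tmap_id. Qed.

Lemma tmap_tassocV {U V W T : lmodType k} (f : {linear W -> T}) (x : U ⊗ (V ⊗ W)) :
  tmap idl f (tassocV x) = tassocV (tmap idl (tmap idl f) x).
Proof. by rewrite tassocV_nat; apply: eq_tmap => // y; rewrite tmap_id. Qed.

(** Every structure map that is defined by recursion on the tensor power, by
    acting on the tail and reassociating, inherits a coassociativity law from
    the tail by one instance of the pentagon. The law may be known only on a
    subspace, which is what the cotensor condition needs. *)
Lemma rext_coassoc_in {U V A B D E T : lmodType k} (f : {linear A -> B ⊗ D})
    (g : {linear V -> A ⊗ T}) (g' : {linear V -> B ⊗ E}) (h : {linear E -> D ⊗ T})
    (S : submodClosed V) :
  {in S, forall v, tassoc (tmap f idl (g v)) = tmap idl h (g' v)} ->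
  forall x : U ⊗ V, x \in tensS (fullS U) S ->
    tassoc (tmap (tassocV \o tmap idl f) idl (tassocV (tmap idl g x))) =
    tmap idl h (tassocV (tmap idl g' x)).
Proof.
move=> fg x xS; rewrite -tmap_compl -tassocV_nat pentagonV !tmap_compr.
rewrite tmap_tassocV tmap_compr; congr (tassocV _).
by apply: (eq_tmap_in _ _ xS) => // v; exact: fg.
Qed.

Lemma rext_coassoc {U V A B D E T : lmodType k} (f : {linear A -> B ⊗ D})
    (g : {linear V -> A ⊗ T}) (g' : {linear V -> B ⊗ E}) (h : {linear E -> D ⊗ T}) :
  (forall v, tassoc (tmap f idl (g v)) = tmap idl h (g' v)) ->
  forall x : U ⊗ V,
    tassoc (tmap (tassocV \o tmap idl f) idl (tassocV (tmap idl g x))) =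
    tmap idl h (tassocV (tmap idl g' x)).
Proof.
move=> fg x; apply: (rext_coassoc_in (S := fullS V)); last exact: mem_tensS_full.
by move=> v _; exact: fg.
Qed.

(** A map acting on the head commutes with one acting on the tail, up to the
    pentagon. *)
Lemma lrext_coassoc {A B D V T E : lmodType k} (f : {linear A -> B ⊗ D})
    (g : {linear V -> T ⊗ E}) (x : A ⊗ V) :
  tassoc (tmap (tassoc \o tmap f idl) idl (tassocV (tmap idl g x))) =
  tmap idl (tassocV \o tmap idl g) (tassoc (tmap f idl x)).
Proof.
rewrite -tmap_compl -tassocV_tmapr tmap_lr pentagon -[in RHS]tmap_compr.
by rewrite -tassoc_tmapl tmap_rl.
Qed.

(** The counterpart of [rext_coassoc] for the left coaction, which acts on the
    head. *)
Lemma lext_coassoc {A C V : lmodType k} (f : {linear A -> C ⊗ A})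
    (g : {linear C -> C ⊗ C}) :
  (forall a, tassoc (tmap g idl (f a)) = tmap idl f (f a)) ->
  forall x : A ⊗ V,
    tassoc (tmap g idl (tassoc (tmap f idl x))) =
    tmap idl (tassoc \o tmap f idl) (tassoc (tmap f idl x)).
Proof.
move=> fg x; rewrite -tmap_compr.
rewrite tmap_tassoc -tassoc_nat !tmap_compl pentagonA; congr (tmap _ _ (tassoc _)).
by rewrite tmap_compl; apply: eq_tmap => // y; rewrite /= fg.
Qed.

(** A right factor [V] does not affect the balancing between [A] and [B]. *)
Lemma cotens_ext_in {A B D V : lmodType k} (f : {linear A -> A ⊗ D})
    (g : {linear B -> D ⊗ B}) (S : submodClosed (A ⊗ B)) :
  {in S, forall y, tassoc (tmap f idl y) = tmap idl g y} ->
  forall x : (A ⊗ B) ⊗ V, x \in tensS S (fullS V) ->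
    tassoc (tmap f idl (tassoc x)) = tmap idl (tassoc \o tmap g idl) (tassoc x).
Proof.
move=> fg x xS; rewrite -tmap_compr.
rewrite tmap_tassoc -tassoc_nat pentagonA tmap_compl; congr (tmap _ _ (tassoc _)).
by apply: (eq_tmap_in _ _ xS).
Qed.

Lemma contrl_assoc {C V W : lmodType k} (e : {linear C -> k^o}) (x : (C ⊗ V) ⊗ W) :
  contrl e (tassoc x) = tmap (contrl e) idl x.
Proof.
move: x; apply: (tens3l_ext (f := contrl e \o tassoc) (g := tmap (contrl e) idl)).
move=> c v w; rewrite /= tassocE tmapE !contrlE.
by have := pure_linearl w (e c) v 0; rewrite addr0 pure0l addr0 => ->.
Qed.

Lemma contrr_assoc {C V W : lmodType k} (e : {linear C -> k^o}) (x : V ⊗ (W ⊗ C)) :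
  contrr e (tassocV x) = tmap idl (contrr e) x.
Proof.
move: x; apply: (tens3_ext (f := contrr e \o tassocV) (g := tmap idl (contrr e))).
move=> v w c; rewrite /= tassocVE tmapE !contrrE.
by have := pure_linearr v (e c) w 0; rewrite addr0 pure0 addr0 => ->.
Qed.

End Coassociativity.

Section Degcast.
Context {k : fieldType} (T : nat -> lmodType k).

Lemma degcast_id n x : degcast T n n x = x.
Proof. by rewrite /degcast; case: eqP => // e; rewrite (eq_irrelevance e erefl). Qed.

Lemma degcast_ne m n x : m != n -> degcast T m n x = 0.
Proof. by rewrite /degcast; case: eqP. Qed.

End Degcast.

(** * Deconcatenation and outer coactions on the tensor powers *)

Section Ambient.
Context {k : fieldType} (X : focc k).
Local Notation C := (focc_base X).
Local Notation W := (focc_mod X).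
Local Notation T := (tpow X).
Local Notation lam := (tpow_lcoact X).
Local Notation rho := (tpow_rcoact X).

(** The $(i,j)$ component of the deconcatenation coproduct on
    $\mathscr{W}_1^{\otimes(n+1)}$, zero unless $n = i + j + 1$. Indexing it by
    an independent [n] avoids transports along equalities between degrees. *)
Definition cut n i j : {linear T n -> T i ⊗ T j} :=
  deconc X i j \o degcast T n (i + j).+1.

Arguments cut : simpl never.

Lemma cut_ne n i j x : n != (i + j).+1 -> cut n i j x = 0.
Proof. by move=> ne; rewrite /cut /= degcast_ne // linear0. Qed.

Lemma cut0 j x : cut j.+1 0 j x = x.
Proof. by rewrite /cut /= degcast_id. Qed.

Lemma cutS n i j x : cut n.+1 i.+1 j x = tassocV (tmap idl (cut n i j) x).
Proof.
move: x; have [-> x|ne x] := eqVneq n (i + j).+1.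
  transitivity (deconc X i.+1 j x).
    exact: (congr1 (deconc X i.+1 j) (@degcast_id _ T (i.+1 + j).+1 x)).
  congr (tassocV _).
  by apply: eq_tmap => // y; rewrite /= degcast_id.
by rewrite cut_ne ?eqSS // tmap0r ?linear0 // => y; rewrite cut_ne.
Qed.

(** Deconcatenation is coassociative on the whole tensor power. The induction on
    [i] peels off the first tensor factor, which [rext_coassoc] allows. *)
Lemma cutA n i j l x :
  tassoc (tmap (cut (i + j).+1 i j) idl (cut n (i + j).+1 l x)) =
  tmap idl (cut (j + l).+1 j l) (cut n i (j + l).+1 x).
Proof.
move: x; have [-> x|ne x] := eqVneq n ((i + j).+1 + l).+1; last first.
  by rewrite !cut_ne ?linear0 // addnS addnA.
elim: i x => [|i IH] x.
  rewrite (_ : tmap _ idl _ = cut (j.+1 + l).+1 j.+1 l x); last first.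
    by rewrite -[RHS]tmap_id; apply: eq_tmap => // z; exact: cut0.
  by rewrite cutS tassocVK [in RHS]cut0.
have := rext_coassoc IH x; rewrite -!cutS => <-; congr (tassoc _).
rewrite -[cut _ (i.+1 + j).+1 l x]/(cut ((i + j).+1 + l).+2 (i + j).+2 l x) cutS.
by apply: eq_tmap => // y; rewrite cutS.
Qed.

Lemma lam_cut n i j x :
  tmap idl (cut n i j) (lam n x) = tassoc (tmap (lam i) idl (cut n i j x)).
Proof.
have [e|ne] := eqVneq n (i + j).+1; last first.
  by rewrite cut_ne // !linear0 tmap0r // => y; rewrite cut_ne.
subst n; case: i x => [|i] x.
  rewrite cut0 -[RHS](tmap_id (tassoc _)); apply: eq_tmap => // y; exact: cut0.
rewrite cutS lrext_coassoc; apply: eq_tmap => // y; exact: cutS.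
Qed.

Lemma rho_cut n i j x :
  tassoc (tmap (cut n i j) idl (rho n x)) = tmap idl (rho j) (cut n i j x).
Proof.
move: x; have [-> x|ne x] := eqVneq n (i + j).+1; last first.
  by rewrite cut_ne // !linear0 tmap0l ?linear0 // => y; rewrite cut_ne.
elim: i x => [|i IH] x.
  rewrite cut0 -[RHS]tassocVK; congr (tassoc _).
  by rewrite -[RHS](tmap_id (tassocV _)); apply: eq_tmap => // y; exact: cut0.
rewrite cutS -(rext_coassoc IH x); congr (tassoc _).
by apply: eq_tmap => // y; exact: cutS.
Qed.

Lemma lamA n x : tassoc (tmap (comul C) idl (lam n x)) = tmap idl (lam n) (lam n x).
Proof.
case: n x => [|n] x; first exact: lcoactA.
exact: lext_coassoc (@lcoactA _ _ W) x.
Qed.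

Lemma rhoA n x : tassoc (tmap (rho n) idl (rho n x)) = tmap idl (comul C) (rho n x).
Proof.
elim: n x => [|n IH] x; first exact: rcoactA.
exact: rext_coassoc IH x.
Qed.

Lemma lam_rho n x : tassoc (tmap (lam n) idl (rho n x)) = tmap idl (rho n) (lam n x).
Proof.
case: n x => [|n] x; first exact: lrcoact.
exact: lrext_coassoc.
Qed.

Lemma lam1 n x : contrl (counit C) (lam n x) = x.
Proof.
case: n x => [|n] x; first exact: lcoact1.
rewrite /= contrl_assoc tmap_comp -[RHS]tmap_id.
by apply: eq_tmap => // y; exact: lcoact1.
Qed.

Lemma rho1 n x : contrr (counit C) (rho n x) = x.
Proof.
elim: n x => [|n IH] x; first exact: rcoact1.
rewrite /= contrr_assoc tmap_comp -[RHS]tmap_id.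
by apply: eq_tmap => // y; exact: IH.
Qed.

End Ambient.
Arguments cut {k} X n i j : simpl never.

(** * The maximal prolongation as a recursively defined subspace *)

Section Prolongation.
Context {k : fieldType} (X : focc k).
Local Notation C := (focc_base X).
Local Notation W := (focc_mod X).
Local Notation T := (tpow X).
Local Notation lam := (tpow_lcoact X).
Local Notation rho := (tpow_rcoact X).
Local Notation delta := (focc_d X).
Local Notation phi := (ufocc_map (focc_d X)).
Local Notation W2 := (max_sub2 X).

(** A linear condition holds on $\mathscr{W}_2^{\mathrm{max}}$ as soon as it
    holds on each of the bicomodules that span it. *)
Lemma max_sub2_ind (B : submodClosed (T 1)) :
  (forall S : submodClosed (T 1), {subset S <= cotpow X 1} ->
     sub_bicomodule (lam 1) (rho 1) S ->
     {in S, forall s, max_check2 X s \in lin_im phi} ->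
     {subset S <= W2} -> {subset S <= B}) ->
  {subset W2 <= B}.
Proof.
move=> h; apply: span_min => u [S [S1 S2 S3 uS]].
apply: (h S) => // v vS; apply: span_sub; by exists S.
Qed.

Lemma max_sub2_max (S : submodClosed (T 1)) : {subset S <= cotpow X 1} ->
  sub_bicomodule (lam 1) (rho 1) S ->
  {in S, forall s, max_check2 X s \in lin_im phi} -> {subset S <= W2}.
Proof. by move=> S1 S2 S3 u uS; apply: span_sub; exists S. Qed.

Lemma cotpow1P u :
  (u \in cotpow X 1) = (u \in cotens (rcoact W) (lcoact W)).
Proof.
apply/idP/idP; first by case/andP.
move=> h; apply/andP; split=> //; exact: mem_tensS_full.
Qed.

Lemma max_sub2_cotens u : u \in W2 -> u \in cotens (rcoact W) (lcoact W).
Proof.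
by apply: max_sub2_ind => S S1 _ _ _ v /S1; rewrite cotpow1P.
Qed.

Lemma max_sub2_cotensE :
  {in W2, forall u, tassoc (tmap (rcoact W) idl u) = tmap idl (lcoact W) u}.
Proof. by move=> u /max_sub2_cotens/eqP/eqP; rewrite subr_eq0 => /eqP. Qed.

Lemma max_sub2_lcoact : {in W2, forall u, lam 1 u \in tensS (fullS C) W2}.
Proof.
move=> u; apply: (max_sub2_ind (B := preimS (lam 1) _)) => S _ [S2 _] _ SW v /S2.
exact: tensS_sub.
Qed.

Lemma max_sub2_rcoact : {in W2, forall u, rho 1 u \in tensS W2 (fullS C)}.
Proof.
move=> u; apply: (max_sub2_ind (B := preimS (rho 1) _)) => S _ [_ S2] _ SW v /S2.
exact: tensS_sub.
Qed.

(** $\mathscr{W}_2^{\mathrm{max}} \otimes \mathscr{W}_1^{\otimes n}$ inside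
    $\mathscr{W}_1^{\otimes(n+2)}$. *)
Definition max_head n : submodClosed (T n.+1) :=
  match n with
  | 0 => W2
  | m.+1 => preimS (cut X m.+2 1 m) (tensS W2 (fullS (T m)))
  end.

(** A description of $\mathscr{W}_{n+1}^{\mathrm{max}}$ by induction on the
    degree: the first two factors lie in $\mathscr{W}_2^{\mathrm{max}}$ and the
    factors after the first one form an element of the previous prolongation.
    All cotensor conditions follow from those of $\mathscr{W}_2^{\mathrm{max}}$
    ([max_rec_cotens]), so that only tensor products of subspaces occur. It
    agrees with the intersection that defines the prolongation ([max_subE]). *)
Fixpoint max_rec n : submodClosed (T n) :=
  match n with
  | 0 => fullS W
  | m.+1 => capS (max_head m) (tensS (fullS W) (max_rec m))
  end.

Lemma max_rec_tail n u : u \in max_rec n.+1 -> u \in tensS (fullS W) (max_rec n).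
Proof. by case/andP. Qed.

Lemma max_rec1 u : (u \in max_rec 1) = (u \in W2).
Proof.
by apply/idP/idP=> [/andP[]//|h]; apply/andP; split=> //; exact: mem_tensS_full.
Qed.

Lemma max_rec_head n u :
  u \in max_rec n.+2 -> cut X n.+2 1 n u \in tensS W2 (fullS (T n)).
Proof. by case/andP. Qed.

(** The coaction touches the first factor only. The tail is therefore preserved,
    and the condition on the first two factors is preserved because
    $\mathscr{W}_2^{\mathrm{max}}$ is a bicomodule. *)
Lemma max_rec_lcoact n u :
  u \in max_rec n -> lam n u \in tensS (fullS C) (max_rec n).
Proof.
case: n u => [|n] u; first by move=> _; exact: mem_tensS_full.
move=> /andP[uh ut]; apply: tensS_capr; last first.
  apply: tensS_assoc; apply: (tensS_tmap (A := fullS W) _ _ ut) => //.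
  by move=> w _; exact: mem_tensS_full.
case: n u uh {ut} => [|n] u uh; first exact: max_sub2_lcoact.
apply: tensS_preimr; rewrite lam_cut; apply: tensS_assoc.
by apply: (tensS_tmap (A := W2) _ _ uh) => // y; exact: max_sub2_lcoact.
Qed.

Lemma max_rec_rcoact n u :
  u \in max_rec n -> rho n u \in tensS (max_rec n) (fullS C).
Proof.
elim: n u => [|n IH] u; first by move=> _; exact: mem_tensS_full.
move=> /andP[uh ut]; apply: tensS_capl; last first.
  by apply: tensS_assocV; apply: (tensS_tmap (A := fullS W) _ _ ut).
case: n u uh {IH ut} => [|n] u uh; first exact: max_sub2_rcoact.
apply: tensS_preiml; rewrite -[tmap _ _ _]tassocK rho_cut; apply: tensS_assocV.
by apply: (tensS_tmap (A := W2) _ _ uh) => // y _; exact: mem_tensS_full.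
Qed.

(** The conditions on the first factors of an element are conditions on its
    first [i] factors; coassociativity of [cut] puts them in the form that the
    recursive description of [max_rec] requires. *)
Lemma max_rec_cutl i j u : u \in max_rec (i + j).+1 ->
  cut X (i + j).+1 i j u \in tensS (max_rec i) (fullS (T j)).
Proof.
elim: i u => [|i IH] u hu; first exact: mem_tensS_full.
apply: tensS_capl; last first.
  have := max_rec_tail hu; rewrite cutS => ut; apply: tensS_assocV.
  exact: (tensS_tmap (A := fullS W) _ _ ut).
case: i u hu {IH} => [|i] u hu; first exact: max_rec_head hu.
apply: tensS_preiml; rewrite -[tmap _ _ _]tassocK (@cutA _ X _ 1); apply: tensS_assocV.
apply: (tensS_tmap (A := W2) _ _ (max_rec_head hu)) => // y _; exact: mem_tensS_full.
Qed.

Lemma max_rec_cutr i j u : u \in max_rec (i + j).+1 ->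
  cut X (i + j).+1 i j u \in tensS (fullS (T i)) (max_rec j).
Proof.
elim: i u => [|i IH] u hu; first by rewrite cut0; exact: max_rec_tail.
have := max_rec_tail hu; rewrite cutS => ut.
apply: (tensS_sub (A := tensS (fullS W) (fullS (T i))) (B := max_rec j)) => //.
by apply: tensS_assocV; exact: (tensS_tmap (A := fullS W) _ _ ut).
Qed.

Lemma max_rec_cut i j u : u \in max_rec (i + j).+1 ->
  cut X (i + j).+1 i j u \in tensS (max_rec i) (max_rec j).
Proof. by move=> hu; apply: tensS_cap; [exact: max_rec_cutl|exact: max_rec_cutr]. Qed.

Lemma cut10 n u : cut X n.+2 1 n u = tassocV u.
Proof.
rewrite cutS; congr (tassocV _); rewrite -[RHS]tmap_id.
by apply: eq_tmap => // y; exact: cut0.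
Qed.

(** Consecutive factors lie in $\mathscr{W}_2^{\mathrm{max}}$, hence in the
    cotensor product, and the inner coactions see only the two factors at the
    cut. *)
Lemma max_rec_cotens i j u : u \in max_rec (i + j).+1 ->
  tassoc (tmap (rho i) idl (cut X (i + j).+1 i j u)) =
  tmap idl (lam j) (cut X (i + j).+1 i j u).
Proof.
elim: i u => [|i IH] u hu; last first.
  rewrite cutS; exact: (rext_coassoc_in IH (max_rec_tail hu)).
rewrite cut0; case: j u hu => [|j] u; first by rewrite max_rec1; exact: max_sub2_cotensE.
move=> /max_rec_head; rewrite cut10 -{2 3}[u]tassocVK => hy;
exact: (cotens_ext_in max_sub2_cotensE hy).
Qed.

(** $\mathscr{W}_1^{\otimes i} \otimes \mathscr{W}_2^{\mathrm{max}} \otimes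
    \mathscr{W}_1^{\otimes j}$ with $i + j + 1 = n$, without the cotensor
    conditions, and built one factor at a time. This form makes the passage to
    the tail immediate. *)
Fixpoint slot n i : submodClosed (T n) :=
  match n, i with
  | 0, _ => fullS W
  | m.+1, 0 => max_head m
  | m.+1, i'.+1 => tensS (fullS W) (slot m i')
  end.

Lemma max_rec_slotP n u :
  (forall i, (i < n)%N -> u \in slot n i) -> u \in max_rec n.
Proof.
elim: n u => [|n IH] u hu //; apply/andP; split; first exact: (hu 0).
have [B uB BS] := @tensS_bigcapr _ _ _ (slot n) n u (fun i => hu i.+1).
by apply: (tensS_sub _ _ uB) => // v vB; apply: IH => i; exact: BS.
Qed.

Lemma max_sub2r_head j : {subset max_sub2r X j <= max_head j}.
Proof.
case: j => [|j] u //=; rewrite /cotensS => /andP[h _].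
rewrite unfold_in /preim_pred /cut /= degcast_id.
exact: (tensS_sub _ _ h).
Qed.

(** The first [i] factors are split off one by one, each time with
    [tensS_preimr]. *)
Lemma max_slot_slot i j : {subset max_slot X i j <= slot (i + j.+1) i}.
Proof.
case: i => [|i] u; first exact: max_sub2r_head.
move=> /andP[h _]; have {h} : deconc X i j.+1 u \in tensS (fullS _) (max_head j).
  by apply: tensS_sub h => //; exact: max_sub2r_head.
elim: i u => [|i IH] u h; first exact: h.
have /tensS_preimr : tmap idl (deconc X i j.+1) u \in
    tensS (fullS W) (tensS (fullS (T i)) (max_head j)).
  rewrite -[tmap _ _ _]tassocVK; apply: tensS_assoc.
  by apply: tensS_sub h => // y _; exact: mem_tensS_full.
by apply: tensS_sub => // y; exact: IH.
Qed.

Lemma max_rec_cotpow n : {subset max_rec n <= cotpow X n}.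
Proof.
elim: n => [|n IH] u // hu; apply/andP; split.
  apply: tensS_sub (max_rec_tail hu) => //.
have := max_rec_cotens (i := 0) hu; rewrite cut0 => e.
by apply/eqP; rewrite /= e subrr.
Qed.

(** From left to right, only the tensor conditions in the definition of the
    prolongation are kept, since [max_rec] consists of these. From right to
    left, the cotensor conditions are recovered with [max_rec_cotens]. *)
Lemma max_subE n : max_sub X n =i max_rec n.
Proof.
move=> u; apply/idP/idP.
  move=> /asboolP hu; apply: max_rec_slotP => i lt_in.
  have e : (i + (n - i.+1).+1)%N = n by rewrite addnS -addSn subnKC.
  move: (hu i (n - i.+1)%N e) => {hu} /max_slot_slot.
  move: (n - i.+1)%N e => j e; subst n; by rewrite degcast_id.
move=> hu; apply/asboolP => i j e; subst n; rewrite degcast_id.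
have head m v : v \in max_rec m.+1 -> v \in max_sub2r X m.
  case: m v => [|m] v hv; first by rewrite max_rec1 in hv.
  have e : deconc X 1 m v = cut X m.+2 1 m v by rewrite /cut /= degcast_id.
  apply/andP; rewrite e; split.
    apply: tensS_sub (max_rec_cut (i := 1) hv) => [y|]; last exact: max_rec_cotpow.
    by rewrite max_rec1.
  by apply/eqP; rewrite /= (max_rec_cotens (i := 1) hv) subrr.
case: i u hu => [|i] u hu; first exact: head.
have e : deconc X i j.+1 u = cut X (i + j.+1).+1 i j.+1 u by rewrite /cut /= degcast_id.
apply/andP; rewrite e; split.
  by apply: tensS_sub (max_rec_cut hu); [exact: max_rec_cotpow|exact: head].
by apply/eqP; rewrite /= (max_rec_cotens hu) subrr.
Qed.

End Prolongation.

(** * The differential *)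

Lemma sum_pure (k : fieldType) (V W : lmodType k) n (v : V) (F : 'I_n -> W) :
  pure v (\sum_i F i) = \sum_i pure v (F i).
Proof. exact: (raddf_sum (mklin (pure_linearr v))). Qed.

Lemma pureZr (k : fieldType) (V W : lmodType k) a (v : V) (w : W) :
  pure v (a *: w) = a *: pure v w.
Proof. exact: (linearZ_LR (mklin (pure_linearr v))). Qed.

Section Differential.
Context {k : fieldType} (X : focc k).
Local Notation C := (focc_base X).
Local Notation W := (focc_mod X).
Local Notation T := (tpow X).
Local Notation lam := (tpow_lcoact X).
Local Notation rho := (tpow_rcoact X).
Local Notation delta := (focc_d X).
Local Notation phi := (ufocc_map (focc_d X)).
Local Notation W2 := (max_sub2 X).
Local Notation d2 := (max_d2 X).
Local Notation max_rec := (max_rec X).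
Local Notation cut := (cut X).

Definition tpow_d n : {linear T n.+1 -> T n} := amb_d X n.+1.

Arguments tpow_d : simpl never.

Lemma tpow_d0 u : tpow_d 0 u = d2 u.
Proof. by rewrite /tpow_d /= /max_d_sum big_ord1 expr0 scale1r. Qed.

(** The terms of the alternating sum that merge later pairs form the
    differential of the tail, with the opposite sign. *)
Lemma tpow_dS n u :
  tpow_d n.+1 u = tmap d2 idl (tassocV u) - tmap idl (tpow_d n) u.
Proof.
rewrite /tpow_d /= [LHS]big_ord_recl expr0 scale1r; congr (_ + _).
have -> : tmap idl (mklin (@max_d_sum_linear k X n)) u =
    \sum_(i < n.+1) (-1) ^+ i *: tmap idl (max_d_at X i n) u.
  move: u; apply: (@tensor_ind _ _ _ (tensor_ex W (T n.+1))).
  - by rewrite linear0 big1 // => i _; rewrite linear0 scaler0.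
  - move=> a x y hx hy; rewrite linearP hx hy scaler_sumr -big_split.
    by apply: eq_bigr => i _; rewrite linearP scalerDr !scalerA mulrC.
  - move=> w v; rewrite [LHS](tmapE idl _ w v) /= /max_d_sum.
    rewrite [LHS]sum_pure; apply: eq_bigr => i _; rewrite pureZr.
    by rewrite (tmapE idl (max_d_at X i n) w v).
rewrite -sumrN; apply: eq_bigr => i _.
by rewrite /= /bump /= add1n exprS mulN1r scaleNr.
Qed.

Lemma tpow_dS_cut n u :
  tpow_d n.+1 u = tmap d2 idl (cut n.+2 1 n u) - tmap idl (tpow_d n) u.
Proof. by rewrite tpow_dS cut10. Qed.

Lemma phi_inj : injective phi.
Proof. by apply: ufocc_map_inj; [exact: focc_coder|exact: focc_inj]. Qed.

(** The co-Leibniz rule between positive degrees is a matter of bookkeeping and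
    holds on the whole tensor power: a merge takes place on the left or on the
    right of the cut. *)
Lemma cut_tpow_d n i j u : cut n i j (tpow_d n u) =
  tmap (tpow_d i) idl (cut n.+1 i.+1 j u) +
  (-1) ^+ i.+1 *: tmap idl (tpow_d j) (cut n.+1 i j.+1 u).
Proof.
move: u; have [-> u|ne u] := eqVneq n (i + j).+1; last first.
  by rewrite !cut_ne ?linear0 ?scaler0 ?addr0 // ?addnS // addSn.
elim: i u => [|i IH] u.
  rewrite !cut0 tpow_dS_cut expr1 scaleN1r; congr (_ - _).
  by apply: eq_tmap => // y; rewrite tpow_d0.
rewrite cutS -[tpow_d _ u]/(tpow_d (i + j).+2 u) tpow_dS !linearB.
rewrite (@cutS _ X (i.+1 + j).+1 i.+1 j) (@cutS _ X (i.+1 + j).+1 i j.+1).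
rewrite (tmapBl (f1 := tmap d2 idl \o tassocV) (f2 := tmap idl (tpow_d i)));
  last exact: tpow_dS.
rewrite -tassocV_nat (tmap_tassocV (tpow_d j)) tmap_rl.
rewrite (tmap_compr idl (cut (i.+1 + j) i j) (tpow_d (i + j).+1)).
rewrite (tmapDr _ (g := cut (i.+1 + j) i j \o tpow_d (i + j).+1)
  (g1 := tmap (tpow_d i) idl \o cut (i + j).+2 i.+1 j)
  (g2 := (-1) ^+ i.+1 \*: (tmap idl (tpow_d j) \o cut (i + j).+2 i j.+1)));
  last exact: IH.
rewrite tmapZr linearD -(tmap_compr idl (tmap (tpow_d i) idl)).
rewrite -(tmap_compr idl (tmap idl (tpow_d j))).
rewrite linearZ_LR opprD addrA; congr (_ - _ + _); last first.
  by rewrite [in RHS]exprS mulN1r scaleNr.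
rewrite -tmap_compl (_ : tmap idl (cut (i.+1 + j).+1 i.+1 j) (u : W ⊗ T (i.+1 + j).+1) =
  tmap idl tassocV (tmap idl (tmap idl (cut (i.+1 + j) i j))
    (u : W ⊗ (W ⊗ T (i.+1 + j))))); last first.
  by rewrite tmap_compr; apply: eq_tmap => // y; exact: cutS.
by rewrite pentagonVV -tassocV_tmapr -tmap_tassocV tmap_lr.
Qed.

(** $\delta = \delta^u \circ \varphi$, so $\delta(\delta_2(w_1 \square w_2)) =
    \delta^u[\delta(w_1) \otimes \delta(w_2)]$, which vanishes because
    $\varepsilon \circ \delta = 0$. *)
Lemma delta_d2 u : u \in W2 -> delta (d2 u) = 0.
Proof.
move=> hu; have dW := @focc_coder _ X.
rewrite -(ufocc_d_map dW) max_d2P // quot_liftE /=.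
move: {hu} u; apply: (tens_ext (g := (\0 : {linear W ⊗ W -> C}))
  (f := (contrl (counit C) \- contrr (counit C)) \o tmap delta delta)) => v w.
by rewrite /= tmapE contrlE contrrE !counit_coder // !scale0r subrr.
Qed.

(** After composing with the injection $\mathrm{id} \otimes \varphi$ this is the
    expansion of $\Delta(\delta(w_1))$ in $\delta(w_1)_{(1)} \otimes
    [\delta(w_1)_{(2)} \otimes \delta(w_2)]$. In the term where $\delta$ is
    applied to $w_1$, the cotensor condition moves the coaction from $w_1$ to
    $w_2$. *)
Lemma lam_d2 u : u \in W2 ->
  lcoact W (d2 u) = tmap delta idl u + tmap idl d2 (lam 1 u).
Proof.
move=> hu; have dW := @focc_coder _ X.
apply: (tmap_inj (f := idl) (g := phi)) => //; first exact: phi_inj.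
rewrite /= -ufocc_map_lcoact // max_d2P // quot_liftE linearD.
rewrite [LHS]/= tmap_compl.
rewrite (tmapDl (f1 := tmap delta idl \o rcoact W) (f2 := tmap idl delta \o lcoact W)) //.
rewrite !linearD; congr (_ + _).
  rewrite -(tmap_splitl _ (_ : {linear W -> _}) delta) tassoc_nat max_sub2_cotensE //.
  by rewrite !tmap_comp; apply: eq_tmap.
rewrite -(tmap_splitl _ (_ : {linear W -> _}) delta) tassoc_nat.
rewrite !tmap_compr; apply: (eq_tmap_in _ _ (max_sub2_lcoact hu)) => // v hv.
exact: (esym (max_d2P hv)).
Qed.

(** As for [lam_d2]. The sign comes from $[\delta(w_{(0)}) \otimes w_{(1)}] = -
    [w_{(-1)} \otimes \delta(w_{(0)})]$, because the sum of the two is the class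
    of $\Delta(\delta(w))$. *)
Lemma rho_d2 u : u \in W2 ->
  rcoact W (d2 u) = tmap d2 idl (rho 1 u) - tmap idl delta u.
Proof.
move=> hu; have dW := @focc_coder _ X.
apply: (tmap_inj (f := phi) (g := idl)) => //; first exact: phi_inj.
rewrite /= -ufocc_map_rcoact // max_d2P // quot_liftE linearB.
rewrite [LHS]/= tmap_compr.
rewrite (tmapDr _ (g1 := tmap delta idl \o rcoact W) (g2 := tmap idl delta \o lcoact W)) //.
rewrite !linearD; congr (_ + _).
  rewrite -(tmap_splitr delta _ (_ : {linear W -> _})) tassocV_nat.
  rewrite !tmap_compl; apply/esym; apply: (eq_tmap_in _ _ (max_sub2_rcoact hu)) => // v hv.
  exact: (max_d2P hv).
rewrite -(tmap_splitr delta _ (_ : {linear W -> _})) -max_sub2_cotensE //.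
rewrite tassocV_nat tassocK !tmap_comp -scaleN1r -tmapZl.
apply: eq_tmap => // w; rewrite /= scaleN1r; apply/eqP; rewrite -addr_eq0 -linearD.
by rewrite -dW ufocc_pi_comul.
Qed.

(** $\delta_2$ is not colinear: its defect [lam_d2] at the first pair is the
    term in which $\delta$ is applied to the first factor, and later pairs are
    merged without any effect on the left coaction. *)
Lemma lam_tpow_d n u : u \in max_rec n.+1 ->
  lam n (tpow_d n u) = tmap delta idl (cut n.+1 0 n u) + tmap idl (tpow_d n) (lam n.+1 u).
Proof.
rewrite cut0; case: n u => [|n] u.
  rewrite max_rec1 tpow_d0 => /lam_d2 ->; congr (_ + _).
  by apply: eq_tmap => // y; rewrite tpow_d0.
move=> /max_rec_head hy; rewrite tpow_dS_cut; set y := cut n.+2 1 n u in hy *.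
have ye : tassoc y = u by rewrite /y cut10 tassocVK.
pose f1 : {linear T 1 -> C ⊗ W} := tmap delta idl.
pose f2 : {linear T 1 -> C ⊗ W} := tmap idl (d2 : {linear T 1 -> W}) \o lam 1.
have e : tmap (lcoact W) idl (tmap d2 idl y) = tmap f1 idl y + tmap f2 idl y.
  rewrite tmap_compl.
  rewrite (eq_tmap_in (f := lcoact W \o d2) (f' := f1 \+ f2) (g' := idl) _ _ hy) //.
    by apply: tmapDl.
  exact: lam_d2.
rewrite -[lam _ _]/(tassoc (tmap (lcoact W) idl _)) !linearB e linearD -addrA.
rewrite -tmap_tassoc ye; congr (_ + _).
rewrite (tmapBr idl (g1 := tmap d2 idl \o cut n.+2 1 n) (g2 := tmap idl (tpow_d n)));
  last exact: tpow_dS_cut.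
congr (_ - _).
  transitivity (tmap idl (tmap (d2 : {linear T 1 -> W}) idl) (tassoc (tmap (lam 1) idl y))).
    by rewrite -tassoc_nat tmap_compl.
  by rewrite -tmap_compr; congr (tmap _ _ _); exact: esym (lam_cut _ _ _).
by rewrite -tassoc_tmapl tmap_rl tmap_lr.
Qed.

(** The defect of the last merge produces the term in which $\delta$ is applied
    to the last factor. *)
Lemma rho_tpow_d n u : u \in max_rec n.+1 ->
  rho n (tpow_d n u) = tmap (tpow_d n) idl (rho n.+1 u) +
    (-1) ^+ n.+1 *: tmap idl delta (cut n.+1 n 0 u).
Proof.
elim: n u => [|n IH] u hu.
  rewrite tpow_d0 rho_d2 -?max_rec1 // cut0 expr1 scaleN1r; congr (_ - _).
  by apply: eq_tmap => // y; rewrite tpow_d0.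
have /max_rec_head hy := hu; have ht := max_rec_tail hu.
pose h1 : {linear T n.+1 -> T n ⊗ C} := tmap (tpow_d n) idl \o rho n.+1.
pose h2 : {linear T n.+1 -> T n ⊗ C} := tmap idl delta \o cut n.+1 n 0.
have e : tmap (idl : {linear W -> W}) (rho n \o tpow_d n) u =
    tmap idl h1 u + (-1) ^+ n.+1 *: tmap idl h2 u.
  rewrite -tmapZr -(tmapDr _ (g := h1 \+ (-1) ^+ n.+1 \*: h2)) //.
  apply: (eq_tmap_in _ _ ht) => // v; exact: IH.
rewrite tpow_dS_cut -[rho _ _]/(tassocV (tmap idl (rho n) _)) !linearB tmap_rl tmap_compr e.
rewrite linearD linearZ_LR -(tmap_compr idl (tmap _ _)) -(tmap_compr idl (tmap _ _)).
rewrite (tmapBl (f1 := tmap d2 idl \o cut n.+2 1 n) (f2 := tmap idl (tpow_d n)));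
  last exact: tpow_dS_cut.
rewrite opprD addrA; congr (_ - _ + _).
- rewrite -(tmap_compl (tmap d2 idl) (cut n.+2 1 n)).
  transitivity (tmap (tmap (d2 : {linear T 1 -> W}) idl) idl
      (tassocV (tmap idl (rho n) (cut n.+2 1 n u)))).
    by rewrite -tassocV_tmapr tmap_lr.
  by congr (tmap _ _ _); rewrite -rho_cut tassocK.
- by rewrite -tassocV_nat.
- by rewrite [in RHS]exprS mulN1r scaleNr cutS tmap_tassocV.
Qed.

(** $\delta_2 \otimes \mathrm{id}$ and $\mathrm{id} \otimes \delta_2$ both fail
    to be balanced, by the same element $w_1 \otimes \delta(w_2) \otimes w_3$;
    the two defects cancel in $\delta_3$. *)
Lemma tpow_d1_cotens u : u \in max_rec 2 ->
  tassoc (tmap (rcoact W) idl (tpow_d 1 u)) = tmap idl (lcoact W) (tpow_d 1 u).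
Proof.
move=> hu; have /max_rec_head := hu; set y := cut 2 1 0 u => hy.
have ht := max_rec_tail hu.
have ye : tassoc y = u by rewrite /y cut10 tassocVK.
pose f1 : {linear T 1 -> W ⊗ C} := tmap (d2 : {linear T 1 -> W}) idl \o rho 1.
pose f2 : {linear T 1 -> W ⊗ C} := tmap idl delta.
have rE : tmap (rcoact W) idl (tmap d2 idl y) = tmap f1 idl y - tmap f2 idl y.
  rewrite tmap_compl -(tmapBl (f := f1 \- f2)) //.
  by apply: (eq_tmap_in _ _ hy) => //; exact: rho_d2.
pose g1 : {linear T 1 -> C ⊗ W} := tmap delta idl.
pose g2 : {linear T 1 -> C ⊗ W} := tmap idl (d2 : {linear T 1 -> W}) \o lam 1.
have lE : tmap idl (lcoact W) (tmap idl d2 u) = tmap idl g1 u + tmap idl g2 u.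
  rewrite tmap_compr -(tmapDr _ (g := g1 \+ g2)) //.
  apply: (eq_tmap_in _ _ ht) => // v; rewrite max_rec1; exact: lam_d2.
have tE : tmap idl (tpow_d 0) u = tmap idl d2 u.
  by apply: eq_tmap => // v; exact: tpow_d0.
rewrite tpow_dS_cut -/y tE !linearB rE lE linearB.
have -> : tassoc (tmap f1 idl y) = tmap idl (lcoact W) (tmap d2 idl y).
  have cE : tassoc (tmap (rho 1) idl y) = tmap idl (lcoact W) y :=
    max_rec_cotens (i := 1) (j := 0) hu.
  transitivity (tmap (d2 : {linear T 1 -> W}) idl (tmap idl (lcoact W) y)).
    by rewrite -cE tmap_tassoc tmap_compl.
  by rewrite tmap_rl tmap_lr.
have -> : tassoc (tmap f2 idl y) = tmap idl g1 u.
  by rewrite -ye -tassoc_nat.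
have -> : tassoc (tmap (rcoact W) idl (tmap idl d2 u)) = tmap idl g2 u.
  have := max_rec_cotens (i := 0) hu; rewrite cut0 => cE.
  by rewrite -[tmap idl g2 u](tmap_compr idl (tmap idl d2)) -cE -tassoc_tmapl tmap_lr tmap_rl.
by rewrite opprD addrA.
Qed.

Lemma check2_tpow_d1 u : u \in max_rec 2 -> max_check2 X (tpow_d 1 u) = 0.
Proof.
move=> hu; have /max_rec_head hy := hu; have ht := max_rec_tail hu.
rewrite tpow_dS_cut linearB.
rewrite -[max_check2 X (tmap d2 _ _)]/(ufocc_pi C (tmap delta delta (tmap d2 idl _))).
rewrite -[max_check2 X (tmap idl _ _)]/(ufocc_pi C (tmap delta delta (tmap idl (tpow_d 0) u))).
rewrite tmap_splitl (tmap_eq0_in _ _ hy); last exact: delta_d2.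
rewrite tmap_splitr (eq_tmap_in (f' := delta) (g' := \0) _ _ ht) //.
  by rewrite tmap0r // !linear0 addr0.
by move=> v; rewrite max_rec1 -[LHS]/(delta (tpow_d 0 v)) tpow_d0; exact: delta_d2.
Qed.

(** $\mathscr{W}_2^{\mathrm{max}}$ is the largest bicomodule with the required
    properties, so it is enough that $\mathscr{W}_2^{\mathrm{max}} +
    \delta_3(\mathscr{W}_3^{\mathrm{max}})$ has them. The first summand is
    needed because the coactions send $\delta_3(u)$ into the sum only. *)
Lemma tpow_d1_mem u : u \in max_rec 2 -> tpow_d 1 u \in W2.
Proof.
pose S : submodClosed (T 1) :=
  Defs.span (fun s => s \in W2 \/ exists2 v, v \in max_rec 2 & s = tpow_d 1 v).
have WS : {subset W2 <= S} by move=> s sW; apply: span_sub; left.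
have dS v : v \in max_rec 2 -> tpow_d 1 v \in S.
  by move=> hv; apply: span_sub; right; exists v.
have Sind (B : submodClosed (T 1)) :
    {subset W2 <= B} -> (forall v, v \in max_rec 2 -> tpow_d 1 v \in B) ->
    {subset S <= B}.
  by move=> WB dB; apply: span_min => s [/WB//|[v hv ->]]; exact: dB.
move=> hu; apply: (max_sub2_max _ _ _ (dS u hu)).
- move=> s hs; rewrite cotpow1P; apply: Sind hs => [v|v hv]; first exact: max_sub2_cotens.
  by apply/eqP; rewrite /= (tpow_d1_cotens hv) subrr.
- split=> s hs.
    apply: (Sind (preimS (lam 1) (tensS (fullS C) S))) hs => v hv.
      by apply: tensS_sub (max_sub2_lcoact hv).
    rewrite unfold_in /preim_pred lam_tpow_d // cut0 rpredD //.
      apply: (tensS_tmap (A := fullS W) _ _ (max_rec_tail hv)) => // y.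
      by rewrite max_rec1; exact: WS.
    exact: (tensS_tmap _ _ (max_rec_lcoact hv)).
  apply: (Sind (preimS (rho 1) (tensS S (fullS C)))) hs => v hv.
    by apply: tensS_sub (max_sub2_rcoact hv).
  rewrite unfold_in /preim_pred rho_tpow_d // rpredD ?rpredZ //.
    exact: (tensS_tmap _ _ (max_rec_rcoact hv)).
  by apply: (tensS_tmap _ _ (max_rec_head hv)) => // y; exact: WS.
- move=> s; apply: (Sind (preimS (max_check2 X) (lin_im phi))) => v hv.
    by apply/lin_imP; exists (d2 v); exact: max_d2P.
  by rewrite unfold_in /preim_pred check2_tpow_d1 ?rpred0.
Qed.

(** By the co-Leibniz rule the first two factors of $\delta(u)$ either arise
    from $\delta_3$, so that [tpow_d1_mem] applies, or are the first two factors
    of $u$. *)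
Lemma tpow_d_mem n u : u \in max_rec n.+1 -> tpow_d n u \in max_rec n.
Proof.
elim: n u => [|n IH] u hu //.
apply/andP; split; last first.
  rewrite tpow_dS_cut rpredB //.
    exact: (tensS_tmap _ _ (max_rec_cutr (i := 1) hu)).
  by apply: (tensS_tmap _ _ (max_rec_tail hu)) => // v; exact: IH.
case: n u hu {IH} => [|n] u hu; first exact: tpow_d1_mem.
rewrite unfold_in /preim_pred cut_tpow_d rpredD ?rpredZ //.
  apply: (tensS_tmap _ _ (max_rec_cutl (i := 2) hu)) => // v; exact: tpow_d1_mem.
by apply: (tensS_tmap _ _ (max_rec_cutl (i := 1) hu)) => // v; rewrite max_rec1.
Qed.

Lemma d2_tpow_d1 u : u \in max_rec 2 -> d2 (tpow_d 1 u) = 0.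
Proof.
move=> hu; apply: phi_inj; rewrite linear0 max_d2P ?tpow_d1_mem //.
exact: check2_tpow_d1.
Qed.

(** The first two factors contribute $\delta_2 \circ \delta_3 = 0$, the tail
    contributes zero by induction, and the mixed terms cancel. *)
Lemma tpow_dd n u : u \in max_rec n.+2 -> tpow_d n (tpow_d n.+1 u) = 0.
Proof.
elim: n u => [|n IH] u hu; first by rewrite tpow_d0; exact: d2_tpow_d1.
rewrite tpow_dS_cut cut_tpow_d linearD tmap_compl.
rewrite (tmap_eq0_in _ _ (max_rec_cutl (i := 2) hu)); last first.
  by move=> v /= hv; exact: d2_tpow_d1.
rewrite add0r exprS expr1 mulN1r opprK scale1r tmap_lr.
rewrite tpow_dS_cut linearB tmap_rl tmap_compr.
rewrite (eq_tmap_in (f' := idl) (g' := \0) _ _ (max_rec_tail hu)) //.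
by rewrite [tmap idl \0 u]tmap0r // subr0 subrr.
Qed.

End Differential.

(** * The maximal prolongation is a dg coalgebra *)

Section MaxDG.
Context {k : fieldType} (X : focc k).
Local Notation C := (focc_base X).
Local Notation W := (focc_mod X).
Local Notation amb := (amb X).
Local Notation amb_comul := (amb_comul X).
Local Notation amb_d := (amb_d X).
Local Notation incl := (max_incl X).

(** The image of the prolongation in the ambient tensor power, with $C$ itself
    in degree zero. *)
Definition amb_sub n : submodClosed (amb n) :=
  match n with 0 => fullS C | m.+1 => max_rec X m end.

Lemma max_incl_mem n x : incl n x \in amb_sub n.
Proof.
case: n x => [|n] x //=; rewrite -max_subE.
by apply/subsp_inclP; exists x.
Qed.

Lemma max_incl_onto n v : v \in amb_sub n -> exists x, incl n x = v.
Proof.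
case: n v => [|n] v /=; first by exists v.
by rewrite -max_subE => /subsp_inclP.
Qed.

Lemma max_incl_inj n : injective (incl n).
Proof. by case: n => [|n] //; exact: subsp_incl_inj. Qed.

Lemma amb_comul_ne n i j x : (i + j)%N != n -> amb_comul n i j x = 0.
Proof.
case: n i j x => [|n] [|i] [|j] x //= ne.
- by rewrite degcast_ne ?linear0 // eq_sym.
- by rewrite degcast_ne ?linear0 //; move: ne; rewrite addn0 eqSS eq_sym.
- by rewrite degcast_ne ?linear0 //; move: ne; rewrite addSn eqSS addnS eq_sym.
Qed.

Lemma amb_comul_lam n : amb_comul n.+1 0 n.+1 = tpow_lcoact X n.
Proof. by apply: linear_eq => x; rewrite /= degcast_id. Qed.

Lemma amb_comul_rho n : amb_comul n.+1 n.+1 0 = tpow_rcoact X n.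
Proof. by apply: linear_eq => x; rewrite /= degcast_id. Qed.

Lemma amb_comul_cut n i j : amb_comul n.+1 i.+1 j.+1 = cut X n i j.
Proof. by []. Qed.

Lemma amb_comul_mem n i j x : x \in amb_sub n ->
  amb_comul n i j x \in tensS (amb_sub i) (amb_sub j).
Proof.
move: x; have [<- x|ne x] := eqVneq (i + j)%N n; last first.
  by rewrite amb_comul_ne // rpred0.
case: i j x => [|i] [|j] x hx; first exact: mem_tensS_full.
- by rewrite amb_comul_lam; exact: max_rec_lcoact.
- move: x hx; rewrite addn0 => x hx.
  by rewrite amb_comul_rho; exact: max_rec_rcoact.
- move: x hx; rewrite addSn addnS => x hx.
  by rewrite amb_comul_cut; exact: max_rec_cut.
Qed.

Lemma amb_d_mem n x : x \in amb_sub n.+1 -> amb_d n x \in amb_sub n.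
Proof. by case: n x => [|n] x //; exact: tpow_d_mem. Qed.

(** One case for each set of zero indices. All of them hold on the ambient
    spaces, except when only the middle index is zero: there the two sides
    differ by the cotensor condition. *)
Lemma amb_comulA n i j l p q x : p = (i + j)%N -> q = (j + l)%N ->
  x \in amb_sub n ->
  tassoc (tmap (amb_comul p i j) idl (amb_comul n p l x)) =
  tmap idl (amb_comul q j l) (amb_comul n i q x).
Proof.
move=> hp hq; move: x; have [e x|ne x _] := eqVneq (i + j + l)%N n; last first.
  by rewrite !amb_comul_ne ?linear0 // ?hp // hq addnA.
subst p q n; case: i j l x => [|i] [|j] [|l] x.
- by move=> _; exact: comulA.
- by rewrite !amb_comul_lam => _; exact: lamA.
- move: x; rewrite !(addn0, add0n) amb_comul_rho amb_comul_lam => x _.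
  exact: lam_rho.
- move: x; rewrite !add0n addSn addnS !(amb_comul_lam, amb_comul_cut) => x _.
  by rewrite lam_cut.
- move: x; rewrite !addn0 !amb_comul_rho => x _; exact: rhoA.
- move: x; rewrite !(addn0, add0n) addSn addnS.
  rewrite !(amb_comul_lam, amb_comul_rho, amb_comul_cut) => x hx.
  exact: max_rec_cotens.
- move: x; rewrite !addn0 addSn addnS !(amb_comul_rho, amb_comul_cut) => x _.
  exact: rho_cut.
- move: x; rewrite !addSn !addnS !addSn !amb_comul_cut => x _.
  exact: cutA.
Qed.

Lemma amb_counit_l n x : contrl (counit C) (amb_comul n 0 n x) = x.
Proof.
case: n x => [|n] x; first exact: counit_l.
by rewrite amb_comul_lam lam1.
Qed.

Lemma amb_counit_r n x : contrr (counit C) (amb_comul n n 0 x) = x.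
Proof.
case: n x => [|n] x; first exact: counit_r.
by rewrite amb_comul_rho rho1.
Qed.

Lemma amb_dd n x : x \in amb_sub n.+2 -> amb_d n (amb_d n.+1 x) = 0.
Proof.
case: n x => [|n] x hx; last exact: tpow_dd.
have := delta_d2 (u := x); rewrite -max_rec1 -tpow_d0; exact.
Qed.

Lemma amb_coder n i j x : x \in amb_sub n.+1 ->
  amb_comul n i j (amb_d n x) =
    tmap (amb_d i) idl (amb_comul n.+1 i.+1 j x) +
    (-1) ^+ i *: tmap idl (amb_d j) (amb_comul n.+1 i j.+1 x).
Proof.
move: x; have [<- x|ne x _] := eqVneq (i + j)%N n; last first.
  by rewrite !amb_comul_ne ?linear0 ?scaler0 ?addr0 // ?addSn ?addnS.
case: i j x => [|i] [|j] x hx.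
- by rewrite amb_comul_lam amb_comul_rho expr0 scale1r; exact: focc_coder.
- rewrite amb_comul_cut !amb_comul_lam expr0 scale1r; exact: lam_tpow_d.
- move: x hx; rewrite addn0 => x hx.
  rewrite amb_comul_cut !amb_comul_rho; exact: rho_tpow_d.
- rewrite !amb_comul_cut; exact: cut_tpow_d.
Qed.

(** The ambient coproduct maps the prolongation into the tensor products of its
    components, so the corestriction by a linear left inverse is a true
    restriction. *)
Lemma max_comulE n i j x :
  tmap (incl i) (incl j) (max_comul X n i j x) = amb_comul n i j (incl n x).
Proof.
have [y hy] := tensS_im (@max_incl_onto i) (@max_incl_onto j)
  (amb_comul_mem i j (max_incl_mem x)).
rewrite /max_comul /= -hy lretrK //.
by apply: tmap_inj; exact: max_incl_inj.
Qed.

Lemma max_dE n x : incl n (max_d X n x) = amb_d n (incl n.+1 x).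
Proof.
have [y hy] := max_incl_onto (amb_d_mem (max_incl_mem x)).
by rewrite /max_d /= -hy lretrK //; exact: max_incl_inj.
Qed.

Lemma max_restrictsP : max_restricts X.
Proof. by split=> *; [exact: max_comulE|exact: max_dE]. Qed.

Lemma max_dg_axioms : dg_axioms (max_prolongation X).
Proof.
have inclT i j := tmap_inj (@max_incl_inj i) (@max_incl_inj j).
split.
- move=> n i j x ne; apply: inclT.
  by rewrite linear0 [LHS]max_comulE amb_comul_ne.
- move=> n i j l x.
  apply: (tmap_inj (@max_incl_inj i) (inclT j l)).
  rewrite -tassoc_nat !tmap_comp.
  rewrite (eq_tmap (f' := amb_comul _ i j \o incl _) (g' := idl \o incl l)); first last.
  - by [].
  - by move=> y; exact: max_comulE.
  rewrite [in RHS](eq_tmap (f' := idl \o incl i) (g' := amb_comul _ j l \o incl _)); first last.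
  - by move=> y; exact: max_comulE.
  - by [].
  rewrite -!tmap_comp [in LHS]max_comulE [in RHS]max_comulE.
  by apply: amb_comulA => //; exact: max_incl_mem.
- move=> n x; apply: (@max_incl_inj n); rewrite -contrl_nat.
  by rewrite -[RHS]amb_counit_l -max_comulE.
- move=> n x; apply: (@max_incl_inj n); rewrite -contrr_nat.
  by rewrite -[RHS]amb_counit_r -max_comulE.
- move=> n x; apply: (@max_incl_inj n).
  by rewrite [LHS]max_dE [max_incl X n.+1 _]max_dE linear0 amb_dd ?max_incl_mem.
- move=> n i j x; apply: inclT.
  rewrite [LHS]max_comulE [incl n _]max_dE amb_coder ?max_incl_mem //.
  rewrite -!max_comulE linearD linearZ_LR !tmap_comp.
  by congr (_ + _ *: _); apply: eq_tmap => // y /=; rewrite max_dE.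
Qed.

End MaxDG.

(** * Codifferentiable maps and their components in degree one *)

Section DegreeOne.
Context {k : fieldType} (D : dgcoalg k) (X : focc k).
Local Notation C := (focc_base X).
Local Notation W := (focc_mod X).
Local Notation delta := (focc_d X).

(** What a codifferentiable map amounts to in degree one, stated on $D_1$
    instead of its quotient $\underline{\mathscr{W}_1}(D_\bullet)$. *)
Definition deg1_compat (f0 : {linear D 0%N -> C}) (f1 : {linear D 1%N -> W}) : Prop :=
  [/\ forall x, lcoact W (f1 x) = tmap f0 f1 (dg_comul D 1 0 1 x),
      forall x, rcoact W (f1 x) = tmap f1 f0 (dg_comul D 1 1 0 x)
    & forall x, delta (f1 x) = f0 (dg_d D 0 x)].

Lemma focc_hom_deg1 (f : focc_hom (dg_focc D) X) :
  exists f1, deg1_compat (f : coalg_hom (dg_deg0 D) C) f1.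
Proof.
have [g [[gl gr] gd]] := focc_homP f.
exists (g \o quot_pi (lin_ker (ufocc_map (dg_d D 0 : {linear dg_deg1 D -> dg_deg0 D})))).
split=> x /=.
- by rewrite gl /= /cores_lcoact /= quot_liftE /= !tmap_comp; apply: eq_tmap.
- by rewrite gr /= /cores_rcoact /= quot_liftE /= !tmap_comp; apply: eq_tmap.
- by rewrite gd /= quot_liftE.
Qed.

(** Such an [f1] factors through the quotient: the injection $\varphi$ into the
    universal FOCC over $C$ turns [f1] into the canonical map of $D_1$, followed
    by $f_0 \otimes f_0$. *)
Lemma deg1_focc_hom (f0 : coalg_hom (dg_deg0 D) C) (f1 : {linear D 1%N -> W}) :
  deg1_compat f0 f1 -> codifferentiable (X := dg_focc D) (Y := X) f0.
Proof.
move=> [fl fr fd].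
have f1K u : u \in lin_ker (ufocc_map (dg_d D 0 : {linear dg_deg1 D -> dg_deg0 D})) ->
    f1 u = 0.
  move=> /eqP/ufocc_pi_eq0[c hc]; apply: (@phi_inj _ X); rewrite linear0.
  rewrite /ufocc_map /= fl tmap_comp (eq_tmap (f' := f0 \o idl) (g' := f0 \o dg_d D 0)) //.
  by rewrite -tmap_comp -hc -coalg_hom_comul ufocc_pi_comul.
exists (quot_lift f1K : {linear cores f0 (focc_mod (dg_focc D)) -> W}).
split; last by move=> x; have [w <-] := quot_piP x; rewrite quot_liftE /= !quot_liftE fd.
split=> x; have [w <-] := quot_piP x; rewrite quot_liftE /= !quot_liftE /=.
  by rewrite fl !tmap_comp; apply: eq_tmap => // y; rewrite /= quot_liftE.
by rewrite fr !tmap_comp; apply: eq_tmap => // y; rewrite /= quot_liftE.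
Qed.

End DegreeOne.

(** * Extension of a codifferentiable map *)

Section Extension.
Context {k : fieldType} (D : dgcoalg k) (X : focc k).
Local Notation C := (focc_base X).
Local Notation W := (focc_mod X).
Local Notation T := (tpow X).
Local Notation lam := (tpow_lcoact X).
Local Notation rho := (tpow_rcoact X).
Local Notation delta := (focc_d X).
Local Notation phi := (ufocc_map (focc_d X)).
Local Notation max_rec := (max_rec X).
Local Notation cut := (cut X).
Local Notation tpow_d := (tpow_d X).
Local Notation com := (dg_comul D).
Local Notation d := (dg_d D).

Lemma dg_coassoc n i j l p q (x : D n) : p = (i + j)%N -> q = (j + l)%N ->
  tassoc (tmap (com p i j) idl (com n p l x)) = tmap idl (com q j l) (com n i q x).
Proof. by move=> -> ->; exact: (dg_comulA (dgcoalgP D)). Qed.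

Context (f0 : coalg_hom (dg_deg0 D) C) (f1 : {linear D 1%N -> W}).
Hypothesis f01 : deg1_compat f0 f1.

(** The only possible extension: in degree $n$ it is $f_1^{\otimes n}$ after the
    iterated coproduct $D_n \to D_1^{\otimes n}$. *)
Fixpoint ext_pos m : {linear D m.+1 -> T m} :=
  match m with
  | 0 => f1
  | m'.+1 => tmap f1 (ext_pos m') \o com m'.+2 1 m'.+1
  end.

Definition ext n : {linear D n -> amb X n} :=
  match n with 0 => f0 : {linear D 0%N -> C} | m.+1 => ext_pos m end.

Local Notation E := ext_pos.

Lemma ext_lam n x : lam n (E n x) = tmap f0 (E n) (com n.+1 0 n.+1 x).
Proof.
have [fl _ _] := f01; case: n x => [|n] x; first exact: fl.
rewrite -[lam _ _]/(tassoc (tmap (lcoact W) idl (tmap f1 (E n) (com n.+2 1 n.+1 x)))).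
rewrite tmap_compl (eq_tmap (f' := tmap f0 f1 \o com 1 0 1) (g' := E n)) //.
by rewrite -tmap_splitl tassoc_nat (dg_coassoc (q := n.+2)) // tmap_splitr.
Qed.

Lemma ext_rho n x : rho n (E n x) = tmap (E n) f0 (com n.+1 n.+1 0 x).
Proof.
have [_ fr _] := f01; elim: n x => [|n IH] x; first exact: fr.
rewrite -[rho _ _]/(tassocV (tmap idl (rho n) (tmap f1 (E n) (com n.+2 1 n.+1 x)))).
rewrite tmap_compr (eq_tmap (f' := f1) (g' := tmap (E n) f0 \o com n.+1 n.+1 0)) //.
rewrite -tmap_splitr tassocV_nat -(dg_coassoc (p := n.+2)) ?addn0 //.
by rewrite tassocK tmap_splitl.
Qed.

Lemma ext_cut n i j x : cut n i j (E n x) = tmap (E i) (E j) (com n.+1 i.+1 j.+1 x).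
Proof.
move: x; have [-> x|ne x] := eqVneq n (i + j).+1; last first.
  by rewrite cut_ne // (dg_comul_deg (dgcoalgP D)) ?linear0 // addSn addnS eqSS eq_sym.
elim: i x => [|i IH] x; first by rewrite cut0.
rewrite cutS.
rewrite -[E (i.+1 + j).+1 x]/(tmap f1 (E (i + j).+1) (com (i + j).+3 1 (i + j).+2 x)).
rewrite tmap_compr.
rewrite (eq_tmap (f' := f1) (g' := tmap (E i) (E j) \o com (i + j).+2 i.+1 j.+1)) //.
rewrite -tmap_splitr tassocV_nat -(dg_coassoc (p := i.+2)) ?addSn ?addnS //.
by rewrite tassocK tmap_splitl.
Qed.

(** The co-Leibniz rule for $\Delta_{0,1} \circ \delta$ has two terms; one of
    them is killed by $\delta^2 = 0$ once $\delta$ is applied to the right leg,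
    the other one is the left-hand side. It shows both that the extension lands
    in $\mathscr{W}_2^{\mathrm{max}}$ and that it commutes with $\delta_2$. *)
Lemma ext_check2 x : max_check2 X (E 1 x) = phi (f1 (d 1 x)).
Proof.
have [fl _ fd] := f01; rewrite /ufocc_map /= fl; congr (ufocc_pi C _).
rewrite !tmap_comp.
rewrite (eq_tmap (f' := f0 \o d 0) (g' := f0 \o d 0)) // -(tmap_comp f0 (d 0) f0).
rewrite [RHS](eq_tmap (f' := f0 \o idl) (g' := f0 \o d 0)) // -(tmap_comp f0 idl f0).
congr (tmap f0 f0 _).
rewrite (dg_coder (dgcoalgP D)) expr0 scale1r linearD tmap_rl tmap_compr.
rewrite [X in _ + X](_ : _ = 0) ?addr0 //.
by apply: tmap0r => y /=; exact: (dg_dd (dgcoalgP D)).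
Qed.

(** By maximality: the image of $D_2$ is a bicomodule with all the properties
    required of $\mathscr{W}_2^{\mathrm{max}}$. *)
Lemma ext1_mem x : E 1 x \in max_sub2 X.
Proof.
have [fl fr _] := f01.
have imE y : E 1 y \in lin_im (E 1) by apply/lin_imP; exists y.
apply: (max_sub2_max (S := lin_im (E 1))) (imE x).
- move=> _ /lin_imP[y <-]; rewrite cotpow1P; apply/eqP/eqP; rewrite subr_eq0; apply/eqP.
  rewrite /= tmap_compl tmap_compr.
  rewrite (eq_tmap (f' := tmap f1 f0 \o com 1 1 0) (g' := f1)) //.
  rewrite [RHS](eq_tmap (f' := f1) (g' := tmap f0 f1 \o com 1 0 1)) //.
  by rewrite -tmap_splitl -tmap_splitr tassoc_nat (dg_coassoc (q := 1)).
- split=> _ /lin_imP[y <-].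
    by rewrite ext_lam; apply: tensS_tmap (mem_tensS_full _) => // z _.
  by rewrite ext_rho; apply: tensS_tmap (mem_tensS_full _) => // z _.
- by move=> _ /lin_imP[y <-]; rewrite ext_check2; apply/lin_imP; eexists.
Qed.

Lemma ext_mem n x : E n x \in max_rec n.
Proof.
elim: n x => [|n IH] x //; apply/andP; split; last first.
  by apply: tensS_tmap (mem_tensS_full _) => // z _; exact: IH.
case: n x {IH} => [|n] x; first exact: ext1_mem.
rewrite unfold_in /preim_pred ext_cut.
by apply: tensS_tmap (mem_tensS_full _) => // z _; exact: ext1_mem.
Qed.

(** In lowest degree by [ext_check2]; then both sides satisfy the same
    recursion, the one for the differential of $D_\bullet$ being its co-Leibniz
    rule in degrees $(1, n)$. *)
Lemma ext_tpow_d n x : tpow_d n (E n.+1 x) = E n (d n.+1 x).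
Proof.
have d2E y : max_d2 X (E 1 y) = f1 (d 1 y).
  by apply: (@phi_inj _ X); rewrite max_d2P ?ext1_mem ?ext_check2.
elim: n x => [|n IH] x; first by rewrite tpow_d0 d2E.
rewrite tpow_dS_cut ext_cut tmap_compl.
rewrite (eq_tmap (f' := f1 \o d 1) (g' := E n)) //.
rewrite -[E n.+2 x]/(tmap f1 (E n.+1) (com n.+3 1 n.+2 x)) tmap_compr.
rewrite (eq_tmap (f := f1) (f' := f1) (g' := E n \o d n.+1)) //.
rewrite -[E n.+1 _]/(tmap f1 (E n) (com n.+2 1 n.+1 (d n.+2 x))).
rewrite (dg_coder (dgcoalgP D)) linearD linearZ_LR expr1 scaleN1r.
by rewrite tmap_splitl tmap_splitr.
Qed.

Lemma ext_comul n i j x :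
  amb_comul X n i j (ext n x) = tmap (ext i) (ext j) (com n i j x).
Proof.
move: x; have [<- x|ne x] := eqVneq (i + j)%N n; last first.
  by rewrite amb_comul_ne // (dg_comul_deg (dgcoalgP D)) // linear0.
case: i j x => [|i] [|j] x; first exact: (coalg_hom_comul f0).
- by rewrite amb_comul_lam; exact: ext_lam.
- move: x; rewrite addn0 => x; rewrite amb_comul_rho; exact: ext_rho.
- by rewrite amb_comul_cut; exact: ext_cut.
Qed.

Lemma ext_d n x : amb_d X n (ext n.+1 x) = ext n (d n x).
Proof. by case: n x => [|n] x; [case: f01|exact: ext_tpow_d]. Qed.

Lemma ext_hom : exists g : dg_hom D (DGCoalg (max_dg_axioms X)),
  forall c : D 0%N, g 0%N c = f0 c.
Proof.
pose g n := lretr (max_incl X n) \o ext n.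
have gE n x : max_incl X n (g n x) = ext n x.
  have : ext n x \in amb_sub X n by case: n x => [|n] x //; exact: ext_mem.
  by move=> /max_incl_onto[y hy]; rewrite /g /= -hy lretrK //; exact: max_incl_inj.
have g_comul n i j x : max_comul X n i j (g n x) = tmap (g i) (g j) (com n i j x).
  apply: (tmap_inj (@max_incl_inj _ X i) (@max_incl_inj _ X j)).
  rewrite max_comulE gE ext_comul tmap_comp; apply: eq_tmap => y; exact: esym (gE _ _).
have g_d n x : max_d X n (g n.+1 x) = g n (d n x).
  by apply: (@max_incl_inj _ X n); rewrite max_dE !gE ext_d.
have g_counit x : counit C (g 0 x) = dg_counit D x.
  by rewrite -[g 0 x]/(max_incl X 0 (g 0 x)) gE; exact: (coalg_hom_counit f0).
exists (@DGHom _ D (DGCoalg (max_dg_axioms X)) g g_comul g_counit g_d) => c.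
exact: gE 0 c.
Qed.

End Extension.

(** A morphism is determined by its degree zero part. In degree one this is the
    injectivity of $w \mapsto w_{(-1)} \otimes \delta(w_{(0)})$; in higher
    degrees, the coproduct component of degree $(1, n)$ is injective. *)
Lemma max_hom_eq (k : fieldType) (D : dgcoalg k) (X : focc k)
    (g h : dg_hom D (DGCoalg (max_dg_axioms X))) : g 0%N =1 h 0%N -> g = h.
Proof.
move=> gh; apply: dg_hom_eq.
have step n i j (u : dg_hom D (DGCoalg (max_dg_axioms X))) x :
    amb_comul X n i j (max_incl X n (u n x)) =
    tmap (max_incl X i \o u i) (max_incl X j \o u j) (dg_comul D n i j x).
  by rewrite -max_comulE [max_comul _ _ _ _ _](dg_hom_comul u) tmap_comp.
have dE n (u : dg_hom D (DGCoalg (max_dg_axioms X))) x :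
    amb_d X n (max_incl X n.+1 (u n.+1 x)) = max_incl X n (u n (dg_d D n x)).
  by rewrite -max_dE [max_d _ _ _](dg_hom_d u).
have gh1 : g 1%N =1 h 1%N.
  move=> x; apply: (@max_incl_inj _ X 1).
  have e (u : dg_hom D (DGCoalg (max_dg_axioms X))) :
      tmap idl (focc_d X) (lcoact (focc_mod X) (max_incl X 1 (u 1%N x))) =
      tmap (u 0%N) (u 0%N \o dg_d D 0) (dg_comul D 1 0 1 x).
    rewrite -[lcoact _ _]/(tpow_lcoact X 0 _) -amb_comul_lam step tmap_compr.
    by apply: eq_tmap => // y; exact: (dE 0).
  by apply: (@focc_inj _ X); rewrite !e; apply: eq_tmap => // y; exact: gh.
elim=> [|[|n] IH] // x; apply: (@max_incl_inj _ X n.+2).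
have e (u : dg_hom D (DGCoalg (max_dg_axioms X))) : max_incl X n.+2 (u n.+2 x) =
    tmap (max_incl X 1 \o u 1%N) (max_incl X n.+1 \o u n.+1) (dg_comul D n.+2 1 n.+1 x).
  by rewrite -step amb_comul_cut cut0.
by rewrite !e; apply: eq_tmap => y /=; rewrite ?gh1 ?IH.
Qed.

(** * The adjunction *)

Section Adjunction.
Context {k : fieldType}.
Let M (X : focc k) : dgcoalg k := DGCoalg (max_dg_axioms X).

Lemma max_extension (X : focc k) (D : dgcoalg k) (f : focc_hom (dg_focc D) X) :
  exists! g : dg_hom D (M X), forall c : D 0%N, g 0%N c = f c.
Proof.
have [f1 f01] := focc_hom_deg1 f; have [g gf] := ext_hom f01.
exists g; split=> // h hf; apply: max_hom_eq => c; by rewrite gf hf.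
Qed.

Definition max_ext (X : focc k) (D : dgcoalg k) (f : focc_hom (dg_focc D) X) :
  dg_hom D (M X) := sval (cid (max_extension f)).

Lemma max_extE X D f c : @max_ext X D f 0%N c = f c.
Proof. by rewrite /max_ext; case: cid => g []. Qed.

Fact max_counit_comul (X : focc k) (c : dg_deg0 (M X)) :
  comul (focc_base X) (max_incl X 0 c) =
  tmap (max_incl X 0) (max_incl X 0) (comul (dg_deg0 (M X)) c).
Proof. by rewrite [RHS]max_comulE. Qed.

(** The counit of the adjunction, in degree zero. It is the identity of $C$, but
    the two coproducts on $C$ are only propositionally equal. *)
Definition max_counit0 (X : focc k) : coalg_hom (dg_deg0 (M X)) (focc_base X) :=
  @CoalgHom _ (dg_deg0 (M X)) _ (max_incl X 0) (@max_counit_comul X) (fun=> erefl).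

Fact max_counit_codiff (X : focc k) :
  codifferentiable (X := dg_focc (M X)) (Y := X) (max_counit0 X).
Proof.
apply: (@deg1_focc_hom _ (M X) X (max_counit0 X) (max_incl X 1)); split=> x.
- by rewrite [RHS]max_comulE amb_comul_lam.
- by rewrite [RHS]max_comulE amb_comul_rho.
- exact/esym/(max_dE (n := 0)).
Qed.

Definition max_counit (X : focc k) : focc_hom (dg_focc (M X)) X :=
  FoccHom (max_counit_codiff X).

(** The extension of [f] composed with the counit of the adjunction. *)
Definition max_map (X Y : focc k) (f : focc_hom X Y) : dg_hom (M X) (M Y) :=
  max_ext (focc_comp f (max_counit X)).

Lemma max_mapE X Y f c : @max_map X Y f 0%N c = f c.
Proof. by rewrite max_extE. Qed.

Lemma max_map_functor : @functor_axioms (FOCC k) (dgCoalg k) M max_map.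
Proof.
split=> [X|X Y Z g f]; apply: max_hom_eq => c; rewrite max_mapE //.
by rewrite /= !max_mapE.
Qed.

(** All equations between morphisms into the prolongation, or between morphisms
    of FOCCs, can be checked in degree zero. *)
Lemma max_right_adjoint : right_adjoint (W1 k) (Functor max_map_functor).
Proof.
exists (fun D X (f : focc_hom (dg_focc D) X) => max_ext f); split.
- move=> D X; exists (fun g => focc_comp (max_counit X) (dg_focc_map g)) => [f|g].
    by apply: focc_hom_eq => c; exact: max_extE.
  by apply: max_hom_eq => c; rewrite max_extE.
- move=> D D' X g f; apply: max_hom_eq => c; rewrite max_extE.
  by rewrite /= max_extE.
- move=> D X Y h f; apply: max_hom_eq => c; rewrite max_extE.
  by rewrite /= max_mapE max_extE.
Qed.

End Adjunction.

Theorem theorem3p19 (k : fieldType) (hk : 2%N \notin [pchar k]) :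
  exists hM : forall X : focc k, dg_axioms (max_prolongation X),
  let M (X : focc k) : dgcoalg k := DGCoalg (hM X) in
  [/\ forall X : focc k, max_restricts X,
      forall (X : focc k) (D : dgcoalg k) (f : focc_hom (dg_focc D) X),
        exists! g : dg_hom D (M X), forall c : D 0%N, g 0%N c = f c
    & exists (Mmap : forall X Y : focc k, focc_hom X Y -> dg_hom (M X) (M Y))
        (hMmap : @functor_axioms (FOCC k) (dgCoalg k) M Mmap),
      (forall (X Y : focc k) (f : focc_hom X Y) (c : focc_base X),
         Mmap X Y f 0%N c = f c) /\
      right_adjoint (W1 k) (Functor hMmap)].
Proof.
exists (@max_dg_axioms k) => M; split; first exact: max_restrictsP.
  exact: max_extension.
exists (@max_map k), (@max_map_functor k); split; first exact: max_mapE.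
exact: max_right_adjoint.
Qed.
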